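(* Let $d\ge 2$ be an integer and let $0<p\le 1$. There is a constant $c>0$, depending only on $d$ and $p$, such that for every integer $N\ge 1$ and every set $\mathcal A_N\subset[0,1]^d$ of cardinality $N$, with discrepancy function $D_N(\vec x)=\sharp(\mathcal A_N\cap[\vec 0,\vec x))-N\,|[\vec 0,\vec x)|$ for $\vec x\in[0,1]^d$, the function $$\widetilde D_N=\Bigl(\sum_{T\subset\{1,\dots,d\}}(-1)^{|T|}\prod_{t\in T}\operatorname{Int}_t\Bigr)D_N=\prod_{t=1}^d(\operatorname{Id}-\operatorname{Int}_t)\,D_N,$$ regarded as a function on $\mathbb R^d$ that vanishes outside the unit cube, satisfies $$\|\widetilde D_N\|_{H^p}\ \ge\ c\,(\log N)^{(d-1)/2}.$$
   Context: For $\vec x=(x_1,\dots,x_d)\in[0,1]^d$, $[\vec 0,\vec x)=\prod_{t=1}^d[0,x_t)$, $|\cdot|$ applied to a set in $\mathbb R^d$ denotes Lebesgue measure, and $\sharp$ denotes cardinality. In the sum over $T$, all subsets $T$ of $\{1,\dots,d\}$ are included, and the term $T=\emptyset$ is the identity operator $\operatorname{Id}$. For $1\le t\le d$, $\operatorname{Int}_t$ is integration in coordinate $t$: $$\operatorname{Int}_t f(\vec x)=\int_0^1 f(x_1,\dots,x_d)\,dx_t .$$ A dyadic rectangle in $\mathbb R^d$ is a product of $d$ dyadic intervals $[j2^k,(j+1)2^k)$, $j,k\in\mathbb Z$ (the scale $k$ may differ between coordinates). $H^p$ denotes the dyadic real-valued Hardy space of $d$ parameters on $\mathbb R^d$, with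 $$\|f\|_{H^p}=\|\operatorname M f\|_{L^p(\mathbb R^d)},\qquad \operatorname M f(x)=\sup_{\substack{x\in R\\ R\text{ dyadic}}}\ \left|\frac1{|R|}\int_R f(y)\,dy\right|,$$ where the supremum is over all dyadic rectangles $R$ in $\mathbb R^d$ containing $x$ (the absolute value is outside the integral, not on $f$). *)

(* Defs.v *)
From HB Require Import structures.
From mathcomp Require Import all_boot all_order all_algebra finmap.
From mathcomp Require Import all_classical all_reals all_analysis.

Set Implicit Arguments.
Unset Strict Implicit.
Unset Printing Implicit Defensive.
Import Order.TTheory GRing.Theory Num.Theory.
Import numFieldNormedType.Exports.
Local Open Scope classical_set_scope.
Local Open Scope ring_scope.

(* Points of R^d are [d.-tuple R], with the product sigma-algebra of the Borel
   sigma-algebras of the coordinates. *)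

Section lebesgue_step.
Context {R : realType} (n : nat).
Variable m : {sigma_finite_measure set (n.-tuple R) -> \bar R}.

Definition tuple_of_pair (z : R * n.-tuple R) : n.+1.-tuple R :=
  [tuple of z.1 :: z.2].

Definition pair_of_tuple (x : n.+1.-tuple R) : R * n.-tuple R :=
  (thead x, [tuple of behead x]).

Lemma pair_of_tupleK : cancel pair_of_tuple tuple_of_pair.
Proof. by move=> x; rewrite /tuple_of_pair/= -tuple_eta. Qed.

Lemma tuple_of_pairK : cancel tuple_of_pair pair_of_tuple.
Proof. by move=> [a x]; congr pair; apply: val_inj. Qed.

Lemma measurable_tuple_of_pair : measurable_fun setT tuple_of_pair.
Proof. exact: measurable_cons. Qed.

Lemma measurable_pair_of_tuple : measurable_fun setT pair_of_tuple.
Proof.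
apply/measurable_fun_pairP; split.
  exact: measurable_tnth.
exact: measurable_behead.
Qed.

Definition lebesgue_step : set (n.+1.-tuple R) -> \bar R :=
  pushforward (lebesgue_measure \x m)%E tuple_of_pair.

Let step0 : lebesgue_step set0 = 0%E.
Proof. by rewrite /lebesgue_step /pushforward preimage_set0 measure0. Qed.

Let step_ge0 A : (0 <= lebesgue_step A)%E.
Proof. by rewrite /lebesgue_step /pushforward measure_ge0. Qed.

Let step_sigma_additive : semi_sigma_additive lebesgue_step.
Proof.
move=> F mF tF mUF; rewrite /lebesgue_step /pushforward preimage_bigcup.
apply: measure_semi_sigma_additive.
- by move=> k; rewrite -[X in measurable X]setTI; exact: measurable_tuple_of_pair.
- apply/trivIsetP => /= i j _ _ ij; rewrite -preimage_setI.
  by move/trivIsetP : tF => /(_ _ _ _ _ ij) ->//; rewrite preimage_set0.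
- rewrite -preimage_bigcup -[X in measurable X]setTI.
  exact: measurable_tuple_of_pair.
Qed.

HB.instance Definition _ :=
  isMeasure.Build _ _ _ lebesgue_step step0 step_ge0 step_sigma_additive.

Let step_sigma_finite : sigma_finite setT lebesgue_step.
Proof.
have /sigma_finiteP[F [TF ndF Foo]] :=
  sigma_finiteT (@lebesgue_measure R).
have /sigma_finiteP[G [TG ndG Goo]] := sigma_finiteT m.
exists (fun k => pair_of_tuple @^-1` (F k `*` G k)).
  apply/esym; rewrite -preimage_bigcup [X in _ @^-1` X](_ : _ = setT)//.
  apply/seteqP; split=> // -[a x] _.
  have [k _ Fka] : (\bigcup_k F k) a by rewrite -TF.
  have [l _ Glx] : (\bigcup_k G k) x by rewrite -TG.
  exists (maxn k l) => //; split => /=.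
  - by move: a Fka; exact/subsetPset/ndF/leq_maxl.
  - by move: x Glx; exact/subsetPset/ndG/leq_maxr.
move=> k; have [mF Fk] := Foo k; have [mG Gk] := Goo k; split.
  rewrite -[X in measurable X]setTI.
  by apply: measurable_pair_of_tuple => //; exact: measurableX.
rewrite /lebesgue_step /pushforward -comp_preimage.
rewrite [X in X @^-1` _](_ : _ = id) ?preimage_id; last first.
  by apply/funext => z /=; rewrite tuple_of_pairK.
by rewrite product_measure1E// lte_mul_pinfty// ge0_fin_numE.
Qed.

HB.instance Definition _ :=
  Measure_isSigmaFinite.Build _ _ _ lebesgue_step step_sigma_finite.

End lebesgue_step.

(* R^0 is a point of mass 1, and lambda_{n+1} is the image of
   lambda_1 x lambda_n under (a, x) |-> a :: x. *)
Fixpoint lebesgueRn {R : realType} (n : nat) :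
    {sigma_finite_measure set (n.-tuple R) -> \bar R} :=
  match n with
  | 0 => \d_([tuple] : 0.-tuple R)
  | n.+1 => lebesgue_step (lebesgueRn n)
  end.

(* Sanity check: the measure of a box is the product of its side lengths. *)
Lemma lebesgueRn_box {R : realType} n (B : 'I_n -> set R) :
  (forall t, measurable (B t)) ->
  lebesgueRn n [set x | forall t, B t (tnth x t)] =
  (\prod_(t < n) lebesgue_measure (B t))%E.
Proof.
elim: n => [|n IH] in B * => mB.
  rewrite big_ord0 /= diracE mem_set//; first by move=> [].
rewrite big_ord_recl -IH// /= /lebesgue_step /pushforward.
rewrite [X in _ X = _](_ : _ = B ord0 `*` [set x | forall t : 'I_n,
    B (lift ord0 t) (tnth x t)]); last first.
  apply/seteqP; split=> [[a x] /= Bax | [a x] /= [Ba Bx] t].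
    by split=> [|t]; [exact: (Bax ord0)|have := Bax (lift ord0 t); rewrite tnthS].
  by have [j ->|->] := unliftP ord0 t; rewrite ?tnthS.
rewrite product_measure1E//; first exact: mB.
rewrite [X in measurable X](_ : _ =
    \bigcap_(t in [set: 'I_n]) ((@tnth n R)^~ t @^-1` B (lift ord0 t))).
  apply: fin_bigcap_measurable => // t _; rewrite -[X in measurable X]setTI.
  exact: measurable_tnth.
by apply/seteqP; split=> x /= Bx t; [move=> _|]; exact: Bx.
Qed.

Section discrepancy.
Context {R : realType} (d : nat).
Implicit Types (x : d.-tuple R) (f : d.-tuple R -> R) (A : {fset d.-tuple R}).

Definition unit_cube : set (d.-tuple R) :=
  [set x | forall t, 0 <= tnth x t <= 1].

Definition origin_box x : set (d.-tuple R) :=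
  [set y | forall t, 0 <= tnth y t < tnth x t].

Definition discrepancy A x : R :=
  #|` [fset a in A | a \in origin_box x]%fset|%:R
  - #|` A|%:R * fine (lebesgueRn d (origin_box x)).

Definition set_coord x (t : 'I_d) (s : R) : d.-tuple R :=
  [tuple if i == t then s else tnth x i | i < d].

Definition Int (t : 'I_d) f : d.-tuple R -> R :=
  fun x => \int[lebesgue_measure]_(s in `[0, 1]) f (set_coord x t s).

(* The product of the operators Int_t, t in T, is their composition. *)
Definition IntT (T : {set 'I_d}) : (d.-tuple R -> R) -> d.-tuple R -> R :=
  \big[comp/id]_(t in T) Int t.

Definition mean_free f : d.-tuple R -> R :=
  fun x => \sum_(T : {set 'I_d}) (-1) ^+ #|T| * IntT T f x.

(* Extended by zero outside the unit cube. *)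
Definition tilde_discrepancy A : d.-tuple R -> R :=
  mean_free (discrepancy A) \_ unit_cube.

End discrepancy.

Section hardy.
Context {R : realType} (d : nat).
Implicit Types (x : d.-tuple R) (f : d.-tuple R -> R).

Definition dyadic_interval (j k : int) : set R :=
  [set` `[j%:~R * 2 ^ k, (j + 1)%:~R * 2 ^ k[].

Definition dyadic_rectangle (Q : set (d.-tuple R)) : Prop :=
  exists j k : 'I_d -> int,
    Q = [set x | forall t, dyadic_interval (j t) (k t) (tnth x t)].

Definition average (Q : set (d.-tuple R)) f : R :=
  (fine (lebesgueRn d Q))^-1 * \int[lebesgueRn d]_(y in Q) f y.

Definition dyadic_maximal f x : \bar R :=
  ereal_sup [set `|average Q f|%:E | Q in [set Q | dyadic_rectangle Q /\ Q x]].

Definition hardy_norm (p : R) f : \bar R :=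
  Lnorm (lebesgueRn d) p%:E (dyadic_maximal f).

End hardy.

(* The defining sum agrees with the product of the operators Id - Int_t. *)
Section mean_free_prod.
Context {R : realType} (d : nat).
Local Notation mu := (@lebesgue_measure R).
Local Notation term := (R * ('I_d -> R -> R))%type.
Implicit Types (x : d.-tuple R) (s : seq term) (w : term) (r : seq 'I_d).

Let I01 (h : R -> R) : R := \int[mu]_(y in `[0, 1]) h y.
Let integrable01 (h : R -> R) := mu.-integrable `[0, 1] (EFin \o h).
Let good s := forall w, w \in s -> forall t, integrable01 (w.2 t).
Let value w x : R := w.1 * \prod_t w.2 t (tnth x t).
Let eval s x : R := \sum_(w <- s) value w x.
Let J r w : term := (w.1, fun t => if t \in r then cst (I01 (w.2 t)) else w.2 t).
Let K r w : term :=
  (w.1, fun t => if t \in r then fun y => w.2 t y - I01 (w.2 t) else w.2 t).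

Let mu01 : mu `[0%R, 1%R] = 1%E.
Proof. by rewrite lebesgue_measure_itv/= lte_fin ltr01 sube0. Qed.

Let integrable_cst01 (a : R) : integrable01 (cst a).
Proof.
apply: continuous_compact_integrable; first exact: segment_compact.
by apply: continuous_subspaceT => y; exact: cst_continuous.
Qed.

Let I01_cst (a : R) : I01 (cst a) = a.
Proof. by rewrite /I01 Rintegral_cst//= mu01 mulr1. Qed.

Let Int_value t w : integrable01 (w.2 t) ->
  [/\ forall x, integrable01 (fun y => value w (set_coord x t y)) &
    Int t (value w) = value (J [:: t] w)].
Proof.
move=> iw.
have E x y : value w (set_coord x t y) =
    w.1 * (\prod_(i | i != t) w.2 i (tnth x i)) * w.2 t y.
  rewrite /value (bigD1 t)//= tnth_mktuple eqxx -mulrA [_ * w.2 t y]mulrC.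
  congr (_ * (_ * _)); apply: eq_bigr => i /negbTE it.
  by rewrite tnth_mktuple it.
split=> [x|].
  rewrite /integrable01 (_ : _ \o _ = fun y =>
    ((w.1 * (\prod_(i | i != t) w.2 i (tnth x i)))%:E * (w.2 t y)%:E)%E).
    exact: integrableZl.
  by apply/funext => y /=; rewrite E.
apply/funext => x; rewrite /Int.
under eq_Rintegral do rewrite E.
rewrite RintegralZl// -/(I01 _) /value [in RHS](bigD1 t)//= inE eqxx/= -mulrA.
rewrite [_ * I01 _]mulrC; congr (_ * (_ * _)).
by apply: eq_bigr => i /negbTE it; rewrite inE it.
Qed.

Let Int_eval t s : good s ->
  [/\ forall x, integrable01 (fun y => eval s (set_coord x t y)) &
    Int t (eval s) = eval (map (J [:: t]) s)].
Proof.
elim: s => [_|w s IH gs].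
  have E x : eval [::] x = 0 by rewrite /eval big_nil.
  split=> [x|].
    rewrite (_ : (fun y => _) = cst 0); first exact: integrable_cst01.
    by apply/funext => y; rewrite E.
  apply/funext => x; rewrite E /Int.
  by under eq_Rintegral do rewrite E; rewrite -/(I01 (cst 0)) I01_cst.
have [iw Iw] := Int_value (gs w (mem_head _ _) t).
have [|is_ Is] := IH.
  by move=> v vs; apply: gs; rewrite inE vs orbT.
have E x : eval (w :: s) x = value w x + eval s x by rewrite /eval big_cons.
split=> [x|].
  rewrite /integrable01 (_ : _ \o _ = fun y => ((value w (set_coord x t y))%:E +
    (eval s (set_coord x t y))%:E)%E); last first.
    by apply/funext => y /=; rewrite E.
  by apply: integrableD => //; [exact: iw|exact: is_].
apply/funext => x; rewrite /= [RHS]/eval big_cons -/(eval _ x) -Is -Iw /Int.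
by under eq_Rintegral do rewrite E; rewrite RintegralD//;
  [exact: iw|exact: is_].
Qed.

Let good_J r s : good s -> good (map (J r) s).
Proof.
move=> gs _ /mapP[w ws ->] t /=; case: ifP => _; first exact: integrable_cst01.
exact: gs.
Qed.

Let good_K r s : good s -> good (map (K r) s).
Proof.
move=> gs _ /mapP[w ws ->] t /=; case: ifP => _; last exact: gs.
rewrite /integrable01 (_ : _ \o _ = fun y => ((w.2 t y)%:E - (I01 (w.2 t))%:E)%E)//.
by apply: integrableB => //; [exact: gs|exact: integrable_cst01].
Qed.

Let Int_seq r s : good s ->
  (\big[comp/id]_(t <- r) Int t) (eval s) = eval (map (J r) s).
Proof.
move=> gs; elim: r => [|t r IH].
  rewrite big_nil /= (_ : map _ _ = s)// -[RHS]map_id.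
  by apply: eq_map => -[].
rewrite big_cons /= IH (Int_eval t (good_J gs)).2 -map_comp.
congr eval; apply: eq_map => w; congr pair; apply/funext => i /=.
rewrite !inE; case: eqP => //= ->; case: ifP => //= _.
by rewrite I01_cst.
Qed.

Let IdInt_seq r s : uniq r -> good s ->
  (\big[comp/id]_(t <- r) (fun f => f \- Int t f)) (eval s) =
  eval (map (K r) s).
Proof.
move=> + gs; elim: r => [_|t r IH /= /andP[tr ur]].
  rewrite big_nil /= (_ : map _ _ = s)// -[RHS]map_id.
  by apply: eq_map => -[].
rewrite big_cons /= IH//; apply/funext => x /=.
rewrite (Int_eval t (good_K gs)).2 /eval -map_comp !big_map -sumrB.
apply: eq_bigr => w _; rewrite /value /= -mulrBr; congr (_ * _).
rewrite [X in X - _](bigD1 t)//= [X in _ - X](bigD1 t)//= [RHS](bigD1 t)//= !inE eqxx (negbTE tr)/= [in RHS]mulrBl; congr (_ - _).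
  congr (_ * _); apply: eq_bigr => i /negbTE it; by rewrite inE it.
by congr (_ * _); apply: eq_bigr => i /negbTE it; rewrite !inE it.
Qed.

Let mean_free_eval s : good s ->
  mean_free (eval s) =
  (\big[comp/id]_(t < d) (fun f => f \- Int t f)) (eval s).
Proof.
move=> gs; rewrite IdInt_seq ?index_enum_uniq//; apply/funext => x.
rewrite /mean_free /IntT.
under eq_bigr => T _ do rewrite -big_filter Int_seq// /eval big_map mulr_sumr.
rewrite exchange_big/= /eval big_map; apply: eq_bigr => w _.
under eq_bigr => T _ do rewrite /value/= mulrCA.
rewrite -mulr_sumr /value; congr (_ * _).
transitivity (\prod_t (- I01 (w.2 t) + w.2 t (tnth x t))); last first.
  by apply: eq_bigr => t _ /=; rewrite mem_index_enum addrC.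
rewrite bigA_distr; apply: eq_bigr => T _.
have -> : (-1) ^+ #|T| = \prod_(t in T) (-1 : R) by rewrite prodr_const.
rewrite [\prod_(t in T) _]big_mkcond -big_split/=.
apply: eq_bigr => t _; rewrite mem_filter mem_index_enum andbT.
by case: ifP => _; rewrite ?mulN1r ?mul1r.
Qed.

Let jump_term (a : d.-tuple R) : term :=
  (1, fun t => \1_`]tnth a t, +oo[).

Let discrepancy_eval (A : {fset d.-tuple R}) : [set` A] `<=` @unit_cube R d ->
  exists2 s, good s & discrepancy A = eval s.
Proof.
move=> A01.
exists ((- #|` A|%:R, fun=> fun y => Num.max 0 y)
        :: [seq jump_term a | a <- enum_fset A]).
  move=> w; rewrite inE => /orP[/eqP-> t /=|/mapP[a _ ->] t /=].
    apply: continuous_compact_integrable; first exact: segment_compact.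
    apply: continuous_subspaceT => y.
    by apply: continuous_max => //; exact: cst_continuous.
  apply: measurable_bounded_integrable => //.
    by rewrite [ltLHS]mu01 ltry.
  exists 1; split=> // M M1 y _ /=; apply: le_trans (ltW M1).
  by rewrite indicE; case: (_ \in _); rewrite ?normr1 ?normr0.
apply/funext => x; rewrite /discrepancy /eval big_cons addrC big_map.
congr (_ + _).
  rewrite /value /= mulNr; congr (- (_ * _)).
  rewrite (_ : origin_box x = [set y | forall t, `[0, tnth x t[%classic (tnth y t)]).
    rewrite (lebesgueRn_box (fun t => measurable_itv _)).
    rewrite (eq_bigr (fun t => (Num.max 0 (tnth x t))%:E)) ?prodEFin// => t _.
    rewrite lebesgue_measure_itv/= lte_fin sube0 /Num.max.
    by case: ifP.
  by apply/seteqP; split=> y /= yx t; have := yx t; rewrite in_itv.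
rewrite card_fset_sum1 natr_sum big_fset big_mkcond/=.
apply: eq_big_seq => a aA; have a01 := A01 a aA.
rewrite /value /= mul1r.
under eq_bigr do rewrite indicE/=.
have [ax|ax] := boolP (a \in origin_box x); rewrite /=.
  rewrite big1// => t _.
  by move: ax; rewrite inE => /(_ t) /andP[_ ax]; rewrite mem_set//= in_itv/= ax.
apply/esym/eqP/prodf_eq0.
move: ax; rewrite notin_setE => /existsNP[t axt]; exists t => //.
rewrite memNset//= in_itv/= => /andP[ax _]; apply: axt.
by rewrite ax andbT; have /andP[] := a01 t.
Qed.

Theorem mean_free_discrepancyE (A : {fset d.-tuple R}) :
  [set` A] `<=` @unit_cube R d ->
  mean_free (discrepancy A) =
  (\big[comp/id]_(t < d) (fun f => f \- Int t f)) (discrepancy A).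
Proof. by move=> /discrepancy_eval[s gs ->]; exact: mean_free_eval. Qed.

End mean_free_prod.

(* Main.v *)
Require Import Defs.
From mathcomp Require Import all_boot all_order all_algebra finmap.
From mathcomp Require Import all_classical all_reals all_analysis.
From mathcomp Require Import measurable_realfun ring lra zify.

Set Implicit Arguments.
Unset Strict Implicit.
Unset Printing Implicit Defensive.
Import Order.TTheory GRing.Theory Num.Theory.
Import numFieldNormedType.Exports.
Local Open Scope classical_set_scope.
Local Open Scope ring_scope.

(** The lower bound is Roth's argument, with the maximal function in the place of
    the L^2 norm.  Write f for the mean-free discrepancy function and M for its
    dyadic maximal function.  It is enough to find a set of measure at least
    1/4 on which M >= lam, where lam is a multiple of (log N)^((d-1)/2): the
    L^p (quasi-)norm of M is then at least lam (1/4)^(1/p) ([hardy_norm_ge]).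

    Let u_Q be the average of f over the dyadic rectangle Q.  Suppose that
    M <= lam on a subset F of the unit cube of measure at least 3/4, and let v_Q
    be the proportion of Q that lies in F.  Both families are martingales in each
    coordinate, and v vanishes inside every Q with |u_Q| > lam, because such a Q
    does not meet F.  The estimate [square_function_bound] then says
      sum_Q |Q| (D u_Q)^2 v_Q^2 <= 16^d lam^2,
    where D takes half the difference of the two children in every coordinate,
    so that D u_Q is the normalized Haar coefficient of f.  In one parameter
    it follows by summing by parts the increments of (u v)^2; the coordinates are
    then treated one at a time, each step moving one difference from u to v.  The
    hypothesis keeps |u| <= lam wherever v or a difference of v is nonzero, and
    the differences of v are absorbed by Bessel's inequality.

    The left side is large because of the empty rectangles.  Choose n with
    2N <= 2^n <= 4N.  For each vector r of levels with sum n, there are 2^n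
    rectangles of these levels in the cube, each of volume 2^-n, and at most half
    of them contain a point.  On the others the counting part of D_N contributes
    nothing to D u_Q, and the volume part gives exactly -N |Q| / 4^d
    ([mixed_haar_tilde]).  As N |Q| >= 1/4 and v averages at least 3/4, every r
    contributes at least a constant ([layer_energy]).  There are at least
    n^(d-1) / (d-1)! vectors r, so lam^2 is at least a constant times n^(d-1)
    ([large_bad_set]), and n >= log N. *)

(** * Dyadic codes *)

(** The pair (j, i) codes the interval [i 2^-j, (i+1) 2^-j), and a sequence of d
    codes a rectangle.  Only nonnegative levels and positions are coded: all the
    rectangles of the unit cube are among them. *)
Definition interval_code := (nat * nat)%type.

Definition child (b : bool) (J : interval_code) : interval_code :=
  (J.1.+1, (J.2.*2 + b)%N).

Definition level (m : nat) : seq interval_code := [seq (m, i) | i <- iota 0 (2 ^ m)].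

Definition tree (m : nat) : seq interval_code := flatten [seq level j | j <- iota 0 m].

Fixpoint words (T : Type) (L : seq T) (k : nat) : seq (seq T) :=
  if k is k'.+1 then [seq x :: s | x <- L, s <- words L k'] else [:: [::]].

Fixpoint layer (r : seq nat) : seq (seq interval_code) :=
  if r is j :: r' then [seq J :: s | J <- level j, s <- layer r'] else [:: [::]].

(** Each side is kept or replaced by one of its halves.  One halving is all that a
    difference operator needs, so no transitive closure is taken. *)
Definition refines : rel (seq interval_code) :=
  all2 (fun K J => [|| K == J, K == child false J | K == child true J]).

(** * The square function inequality *)

Section square_function.
Context {R : realFieldType}.
Implicit Types (U V F G : interval_code -> R) (u v : seq interval_code -> R).

Definition len (J : interval_code) : R := 2^-1 ^+ J.1.

Definition volume (s : seq interval_code) : R := \prod_(J <- s) len J.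

Definition wsum (T : Type) (w : T -> R) (L : seq T) (F : T -> R) : R :=
  \sum_(x <- L) w x * F x.

Definition mean2 U (J : interval_code) : R :=
  (U (child false J) + U (child true J)) / 2.

Definition haar U (J : interval_code) : R :=
  (U (child true J) - U (child false J)) / 2.

(** A dyadic martingale in each coordinate separately. *)
Definition martingale u : Prop :=
  forall s1 J s2, u (s1 ++ J :: s2) = mean2 (fun K => u (s1 ++ K :: s2)) J.

(** The difference [haar] applied in every coordinate. *)
Fixpoint mixed_haar (s : seq interval_code) u : R :=
  if s is J :: s' then mixed_haar s' (fun q => haar (fun K => u (K :: q)) J)
  else u [::].

Lemma len_gt0 J : 0 < len J.
Proof. by rewrite exprn_gt0// invr_gt0. Qed.

Lemma len_ge0 J : 0 <= len J.
Proof. exact/ltW/len_gt0. Qed.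

Lemma volume_ge0 s : 0 <= volume s.
Proof. by apply: prodr_ge0 => J _; exact: len_ge0. Qed.

Lemma wsumD T (w : T -> R) L (F G : T -> R) :
  wsum w L (fun x => F x + G x) = wsum w L F + wsum w L G.
Proof. by rewrite /wsum -big_split/=; apply: eq_bigr => x _; rewrite mulrDr. Qed.

Lemma wsumZ T (w : T -> R) L a (F : T -> R) :
  wsum w L (fun x => a * F x) = a * wsum w L F.
Proof. by rewrite /wsum mulr_sumr; apply: eq_bigr => x _; rewrite mulrCA. Qed.

Lemma wsum_swap S T (w : S -> R) (w' : T -> R) L M (F : S -> T -> R) :
  wsum w L (fun x => wsum w' M (F x)) = wsum w' M (fun y => wsum w L (F^~ y)).
Proof.
rewrite /wsum; under eq_bigr do rewrite mulr_sumr.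
rewrite exchange_big/=; apply: eq_bigr => y _; rewrite mulr_sumr.
by apply: eq_bigr => x _; rewrite mulrCA.
Qed.

Lemma ler_wsum T (w : T -> R) L (F G : T -> R) : (forall x, 0 <= w x) ->
  (forall x, F x <= G x) -> wsum w L F <= wsum w L G.
Proof. by move=> w0 FG; apply: ler_sum => x _; rewrite ler_wpM2l. Qed.

Lemma ler_wsum_in (T : eqType) (w : T -> R) (L : seq T) (F G : T -> R) :
  (forall x, 0 <= w x) -> (forall x, x \in L -> F x <= G x) ->
  wsum w L F <= wsum w L G.
Proof.
move=> w0 FG; rewrite /wsum big_seq [leRHS]big_seq.
by apply: ler_sum => x xL; rewrite ler_wpM2l// FG.
Qed.

Lemma wsum_allpairs L M (F : seq interval_code -> R) :
  wsum volume [seq J :: s | J <- L, s <- M] F =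
  wsum len L (fun J => wsum volume M (fun s => F (J :: s))).
Proof.
rewrite /wsum big_allpairs_dep/=; apply: eq_bigr => J _.
by rewrite mulr_sumr; apply: eq_bigr => s _; rewrite /volume big_cons mulrA.
Qed.

Lemma big_words_tree m k (F : seq interval_code -> R) :
  \sum_(s <- words (tree m) k) F s =
  \sum_(r <- words (iota 0 m) k) \sum_(s <- layer r) F s.
Proof.
elim: k F => [|k IH] F /=; first by rewrite !big_seq1.
rewrite big_allpairs_dep [RHS]big_allpairs_dep big_flatten big_map/=.
apply: eq_bigr => j _; under eq_bigr do rewrite IH.
rewrite exchange_big/=; apply: eq_bigr => r _.
by rewrite big_allpairs_dep.
Qed.

(** The positions at level m+1 are the two children of those at level m. *)
Lemma iota_double n : perm_eq (iota 0 n.*2)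
  ([seq i.*2 | i <- iota 0 n] ++ [seq i.*2.+1 | i <- iota 0 n]).
Proof.
apply: uniq_perm; rewrite ?iota_uniq//.
  rewrite cat_uniq !map_inj_uniq ?iota_uniq//=; [|by move=> i j []/double_inj|exact: double_inj].
  by rewrite andbT; apply/hasPn => _ /mapP[i _ ->]; apply/negP => /mapP[j _ /eqP]; lia.
move=> i; rewrite mem_cat mem_iota/=; apply/idP/orP.
  move=> lin; have := odd_double_half i; case: (odd i) => E.
    by right; apply/mapP; exists i./2; [rewrite mem_iota|]; lia.
  by left; apply/mapP; exists i./2; [rewrite mem_iota|]; lia.
by case=> /mapP[j]; rewrite mem_iota => ? ->; lia.
Qed.

Lemma wsum_levelS m F : wsum len (level m.+1) F = wsum len (level m) (mean2 F).
Proof.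
rewrite /wsum /level !big_map expnS mul2n (perm_big _ (iota_double _)).
rewrite big_cat/= !big_map -big_split/=; apply: eq_bigr => i _.
by rewrite /len /mean2 /child/= addn0 addn1 exprS; field.
Qed.

Lemma wsum_level0 F : wsum len (level 0) F = F (0, 0)%N.
Proof. by rewrite /wsum big_seq1 /len expr0 mul1r. Qed.

Lemma wsum_level_martingale U m : U =1 mean2 U -> wsum len (level m) U = U (0, 0)%N.
Proof.
move=> mU; elim: m => [|m IH]; first exact: wsum_level0.
by rewrite wsum_levelS -IH /wsum; apply: eq_bigr => J _; rewrite -mU.
Qed.

Lemma wsum_treeS m F :
  wsum len (tree m.+1) F = wsum len (tree m) F + wsum len (level m) F.
Proof.
by rewrite /wsum /tree -addn1 iotaD map_cat flatten_cat big_cat/= cats0.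
Qed.

(** The averages of F over successive levels increase by the averages of
    [mean2 F - F], and these dominate G. *)
Lemma wsum_tree_telescope F G m : (forall J, 0 <= F J) ->
  (forall J, G J <= mean2 F J - F J) ->
  wsum len (tree m) G <= wsum len (level m) F.
Proof.
move=> F0 FG.
apply: (@le_trans _ _ (wsum len (level m) F - F (0, 0)%N)); last by rewrite gerBl.
elim: m => [|m IH]; first by rewrite wsum_level0 subrr /wsum big_nil.
rewrite wsum_treeS wsum_levelS.
have : wsum len (level m) G <= wsum len (level m) (fun J => mean2 F J + -1 * F J).
  by apply: ler_wsum => J; rewrite ?len_ge0// mulN1r.
rewrite wsumD wsumZ; lra.
Qed.

Lemma bessel_tree V m : V =1 mean2 V ->
  wsum len (tree m) (fun J => haar V J ^+ 2) <=
  wsum len (level m) (fun J => V J ^+ 2).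
Proof.
move=> mV; apply: wsum_tree_telescope => J; first exact: sqr_ge0.
rewrite [V J]mV /mean2 /haar.
by move: (V _) (V _) => a b; rewrite -subr_ge0 [X in _ <= X](_ : _ = 0)//; field.
Qed.

(** If x, y are the mean and half-difference of U on an interval, and z, w those of
    V, then the increment of (U V)^2 exceeds (y z)^2 by a cross term 4 x y z w and
    nonnegative terms, one of them (x w)^2.  In absolute value the cross term is at
    most half of (y z)^2 plus 8 (x w)^2, whence y^2 z^2 <= 2 * increment + 14 (x w)^2, which telescopes.  Nothing has to
    be assumed on the size of U: this is what lets the inequality be iterated. *)
Lemma square_function_tree U V m : U =1 mean2 U -> V =1 mean2 V ->
  wsum len (tree m) (fun J => haar U J ^+ 2 * V J ^+ 2) <=
  2 * wsum len (level m) (fun J => U J ^+ 2 * V J ^+ 2) +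
  14 * wsum len (tree m) (fun J => U J ^+ 2 * haar V J ^+ 2).
Proof.
move=> mU mV.
have : wsum len (tree m) (fun J => haar U J ^+ 2 * V J ^+ 2
    + (- 14) * (U J ^+ 2 * haar V J ^+ 2)) <=
    wsum len (level m) (fun J => 2 * (U J ^+ 2 * V J ^+ 2)).
  apply: wsum_tree_telescope => J.
    by apply: mulr_ge0 => //; apply: mulr_ge0; exact: sqr_ge0.
  rewrite [U J]mU [V J]mV /mean2 /haar.
  move: (U (child false J)) (U (child true J)) => a b.
  move: (V (child false J)) (V (child true J)) => c e.
  have split2 (g h : R) : exists x y, g = x - y /\ h = x + y.
    by exists ((g + h) / 2), ((h - g) / 2); split; field.
  have [x [y [-> ->]]] := split2 a b; have [z [w [-> ->]]] := split2 c e.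
  rewrite -subr_ge0.
  (* The square absorbs the cross term: 16 (x w)^2 = 14 (x w)^2 + 2 (x w)^2. *)
  rewrite [leRHS](_ : _ = (y * z + 4 * (x * w)) ^+ 2 + 2 * (y * w) ^+ 2); last by field.
  by apply: addr_ge0; [|apply: mulr_ge0 => //]; exact: sqr_ge0.
rewrite wsumD !wsumZ; lra.
Qed.

Lemma mixed_haar_lin s a b u v :
  mixed_haar s (fun q => a * u q + b * v q) = a * mixed_haar s u + b * mixed_haar s v.
Proof.
elim: s u v => [//|J s IH] u v /=; rewrite -IH; congr mixed_haar.
by apply/funext => q; rewrite /haar; field.
Qed.

Lemma mixed_haar_mean2 s (u : interval_code -> seq interval_code -> R) J :
  mixed_haar s (fun q => mean2 (u^~ q) J) = mean2 (fun K => mixed_haar s (u K)) J.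
Proof.
rewrite [RHS]/mean2 mulrDl ![_ / 2]mulrC -mixed_haar_lin; congr mixed_haar.
by apply/funext => q; rewrite /mean2; field.
Qed.

Lemma mixed_haar_haar s (u : interval_code -> seq interval_code -> R) J :
  mixed_haar s (fun q => haar (u^~ q) J) = haar (fun K => mixed_haar s (u K)) J.
Proof.
transitivity (2^-1 * mixed_haar s (u (child true J)) +
    (- 2^-1) * mixed_haar s (u (child false J))); last by rewrite /haar; field.
by rewrite -mixed_haar_lin; congr mixed_haar; apply/funext => q; rewrite /haar; field.
Qed.

Lemma martingale_cons u J : martingale u -> martingale (fun q => u (J :: q)).
Proof. by move=> mu s1 K s2; exact: (mu (J :: s1)). Qed.

Lemma martingale_haar u J : martingale u ->
  martingale (fun q => haar (fun K => u (K :: q)) J).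
Proof.
move=> mu s1 K s2; rewrite /haar /mean2.
by rewrite (mu (_ :: s1)) (mu (child false J :: s1)) /mean2 /=; field.
Qed.

(** Induction on the number of parameters.  With the remaining coordinates fixed,
    [square_function_tree] in the first coordinate removes the difference from u in
    exchange for either nothing, at the finest level, or a difference of v.  Both
    terms satisfy the hypotheses in one parameter less: a difference of v vanishes
    wherever v vanishes on all refinements.  Bessel's inequality in the first
    coordinate bounds the second term, giving the factor 2 + 14 = 16. *)
Lemma square_function_bound (lam : R) m k u v : 0 <= lam ->
  martingale u -> martingale v ->
  (forall s, `|u s| <= lam \/ forall q, refines q s -> v q = 0) ->
  wsum volume (words (tree m) k) (fun s => mixed_haar s u ^+ 2 * v s ^+ 2) <=
  16 ^+ k * lam ^+ 2 * wsum volume (words (level m) k) (fun s => v s ^+ 2).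
Proof.
move=> lam0; elim: k u v => [|k IH] u v mu mv uv.
  rewrite /wsum !big_seq1/= expr0 mul1r mulrCA.
  have [ule|v0] := uv [::]; last by rewrite v0// expr0n !mulr0.
  apply: ler_wpM2r; first by rewrite mulr_ge0 ?volume_ge0 ?sqr_ge0.
  by rewrite -real_normK ?num_real// lerXn2r ?nnegrE.
set W := words (tree m) k; set C := 16 ^+ k * lam ^+ 2.
rewrite !wsum_allpairs -!/(words _ _) -/W.
pose U s J := mixed_haar s (fun q => u (J :: q)); pose V s J := v (J :: s).
have mU s : U s =1 mean2 (U s).
  move=> J; rewrite /U -mixed_haar_mean2; congr mixed_haar; apply/funext => q.
  exact: (mu [::]).
have mV s : V s =1 mean2 (V s) by move=> J; exact: (mv [::]).
have -> : wsum len (tree m) (fun J => wsum volume W (fun s =>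
      mixed_haar (J :: s) u ^+ 2 * v (J :: s) ^+ 2)) =
    wsum volume W (fun s => wsum len (tree m) (fun J =>
      haar (U s) J ^+ 2 * V s J ^+ 2)).
  rewrite [RHS]wsum_swap; congr wsum; apply/funext => J; congr wsum; apply/funext => s.
  by rewrite /= (mixed_haar_haar s (fun K q => u (K :: q))).
have step s := square_function_tree m (mU s) (mV s).
apply: le_trans (ler_wsum W volume_ge0 step) _.
rewrite wsumD !wsumZ.
rewrite -(wsum_swap len volume (level m) W (fun J s => U s J ^+ 2 * V s J ^+ 2)).
rewrite -(wsum_swap len volume (tree m) W (fun J s => U s J ^+ 2 * haar (V s) J ^+ 2)).
set X := wsum len (level m) _.
set cells := words (level m) k.
set Y := wsum len (tree m) _.
set Z := wsum len (level m) _.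
have XZ : X <= C * Z.
  rewrite /Z -wsumZ; apply: ler_wsum; first exact: len_ge0.
  move=> J; apply: IH; [exact: martingale_cons|exact: martingale_cons|].
  move=> s; have [?|v0] := uv (J :: s); [by left|right => q qs].
  by apply: v0; rewrite /refines/= eqxx.
have YZ : Y <= C * Z.
  apply: (@le_trans _ _ (C * wsum len (tree m) (fun J =>
      wsum volume cells (fun s => haar (V s) J ^+ 2)))).
    rewrite -wsumZ; apply: ler_wsum; first exact: len_ge0.
    move=> J; apply: IH; [exact: martingale_cons|exact: martingale_haar|].
    move=> s; have [?|v0] := uv (J :: s); [by left|right => q qs].
    by rewrite /haar /V !v0 ?subr0 ?mul0r// /refines/= eqxx ?orbT.
  rewrite ler_wpM2l ?mulr_ge0 ?exprn_ge0//.
  rewrite (wsum_swap len volume _ _ (fun J s => haar (V s) J ^+ 2)).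
  rewrite /Z (wsum_swap len volume _ _ (fun J s => V s J ^+ 2)).
  by apply: ler_wsum => [|s]; [exact: volume_ge0|exact: bessel_tree].
rewrite exprS -mulrA (_ : 16 * _ * _ = 16 * (C * Z)); last by rewrite /C !mulrA.
lra.
Qed.

(** A layer tiles the unit cube, whose code is the sequence of pairs (0, 0). *)
Lemma wsum_layer_martingale v r : martingale v ->
  wsum volume (layer r) v = v (nseq (size r) (0, 0)%N).
Proof.
elim: r v => [|j r IH] v mv.
  by rewrite /wsum big_seq1 /volume big_nil mul1r.
rewrite /= wsum_allpairs.
rewrite (_ : (fun J => _) = fun J => v (J :: nseq (size r) (0, 0)%N)).
  by rewrite (@wsum_level_martingale (fun J => v (J :: _)))// => J; exact: (mv [::]).
by apply/funext => J; rewrite IH//; exact: martingale_cons.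
Qed.
End square_function.

(** * Integrals of products over boxes *)

Section product_integrals.
Context {R : realType}.
Local Notation mu := (@lebesgue_measure R).

Lemma Rintegral_linear_sum d (T : measurableType d)
    (nu : {measure set T -> \bar R}) (D : set T) (I : Type) (s : seq I)
    (c : I -> R) (F : I -> T -> R) : measurable D ->
  (forall i, nu.-integrable D (EFin \o F i)) ->
  \int[nu]_(x in D) (\sum_(i <- s) c i * F i x) =
  \sum_(i <- s) c i * \int[nu]_(x in D) F i x.
Proof.
move=> mD iF; have icF i : nu.-integrable D (EFin \o (fun x => c i * F i x)).
  by rewrite (_ : _ \o _ = fun x => (c i)%:E * (EFin \o F i) x)%E//; exact: integrableZl.
elim: s => [|i s IH].
  under eq_Rintegral do rewrite big_nil; rewrite big_nil.
  by rewrite Rintegral_cst// mul0r.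
under eq_Rintegral do rewrite big_cons; rewrite big_cons RintegralD//.
  by rewrite IH RintegralZl.
rewrite (_ : _ \o _ = fun x => \sum_(j <- s) (EFin \o (fun x => (c j * F j x)%R)) x)%E.
  exact: integrable_sum.
by apply/funext => x /=; rewrite sumEFin.
Qed.

Lemma integral_prod2 d1 d2 (T1 : measurableType d1) (T2 : measurableType d2)
    (m1 : {sigma_finite_measure set T1 -> \bar R})
    (m2 : {sigma_finite_measure set T2 -> \bar R}) (g : T1 -> R) (h : T2 -> R) :
  m1.-integrable setT (EFin \o g) -> m2.-integrable setT (EFin \o h) ->
  (m1 \x m2)%E.-integrable setT (fun z => (g z.1 * h z.2)%:E) /\
  (\int[m1 \x m2]_z (g z.1 * h z.2)%:E =
   \int[m1]_x (g x)%:E * \int[m2]_y (h y)%:E)%E.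
Proof.
move=> ig ih.
have mg : measurable_fun setT g by apply/measurable_EFinP; exact: measurable_int ig.
have mh : measurable_fun setT h by apply/measurable_EFinP; exact: measurable_int ih.
have igh : (m1 \x m2)%E.-integrable setT (fun z => (g z.1 * h z.2)%:E).
  apply/integrable12ltyP.
    by apply/measurable_EFinP; apply: measurable_funM; exact: measurableT_comp.
  under eq_integral => x _.
    under eq_integral => y _ do rewrite /= normrM EFinM.
    rewrite ge0_integralZl//; last first.
      by apply/measurable_EFinP; exact: measurableT_comp.
    over.
  move/integrableP : ih => [_ ih]; move/integrableP : ig => [_ ig].
  rewrite /= ge0_integralZr//; last 2 first.
  - by apply/measurable_EFinP; exact: measurableT_comp.
  - exact: integral_ge0.
  rewrite lte_mul_pinfty// ?integral_ge0// ge0_fin_numE ?integral_ge0//.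
split=> //; rewrite -integral12_prod_meas1// /fubini_F/=.
under eq_integral => x _.
  under eq_integral => y _ do rewrite EFinM.
  rewrite integralZl//.
  over.
rewrite /= -(fineK (integrable_fin_num _ ih))//.
by rewrite -integralZr.
Qed.

(** The sigma-algebra on the first factor is the one that carries
    [lebesgue_measure], so that the image of the product measure can be formed. *)
Lemma measurable_tuple_of_pairR n :
  measurable_fun [set: measurableTypeR R * n.-tuple R] (@tuple_of_pair R n).
Proof. by move=> _ Y mY; exact: (@measurable_tuple_of_pair R n measurableT Y mY). Qed.

Lemma integral_prod_Rn n (g : 'I_n -> R -> R) :
  (forall t, mu.-integrable setT (EFin \o g t)) ->
  (lebesgueRn n).-integrable setT (EFin \o (fun x => \prod_t g t (tnth x t))) /\
  \int[lebesgueRn n]_x (\prod_t g t (tnth x t)) = \prod_t \int[mu]_x g t x.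
Proof.
elim: n g => [|n IH] g ig.
  rewrite big_ord0 (_ : (fun x => _) = cst 1); last first.
    by apply/funext => x; rewrite big_ord0.
  have m0 : lebesgueRn 0 [set: 0.-tuple R] = 1%E by rewrite /= diracE mem_set.
  split; last by rewrite Rintegral_cst// mul1r; exact: (congr1 fine m0).
  apply: measurable_bounded_integrable => //; first by rewrite [ltLHS]m0 ltry.
  exact: bounded_cst.
have [ih Ih] := IH (fun t => g (lift ord0 t)) (fun t => ig _).
set h := (fun x : n.-tuple R => _) in ih Ih.
set f := EFin \o _.
have fE : f \o @tuple_of_pair R n = fun z => (g ord0 z.1 * h z.2)%:E.
  apply/funext => z; rewrite /f /= big_ord_recl /h; congr (_ * _)%:E.
  by apply: eq_bigr => t _; rewrite tnthS.
have mf : measurable_fun setT f.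
  apply/measurable_EFinP; apply: measurable_prod => t _.
  apply: measurableT_comp; last exact: measurable_tnth.
  by apply/measurable_EFinP; exact: measurable_int (ig t).
have [igh Igh] := integral_prod2 (ig ord0) ih.
rewrite -fE in igh.
split.
  exact: (@integrable_pushforward _ _ _ _ R _ (@measurable_tuple_of_pairR n)
    _ setT f mf igh measurableT).
rewrite /Rintegral [X in fine X](_ : _ = \int[mu \x lebesgueRn n]_z (f \o @tuple_of_pair R n) z)%E.
  rewrite fE Igh fineM; last 2 first.
  - exact: integrable_fin_num (ig ord0).
  - exact: integrable_fin_num ih.
  by rewrite big_ord_recl -Ih.
exact: (@integral_pushforward _ _ _ _ R _ (@measurable_tuple_of_pairR n)
  _ setT f mf igh measurableT).
Qed.

Lemma integral_prod_box n (B : 'I_n -> set R) (g : 'I_n -> R -> R) :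
  (forall t, measurable (B t)) ->
  (forall t, mu.-integrable (B t) (EFin \o g t)) ->
  let Q := [set x | forall t, B t (tnth x t)] in
  measurable Q /\
  (lebesgueRn n).-integrable Q (EFin \o (fun x => \prod_t g t (tnth x t))) /\
  \int[lebesgueRn n]_(x in Q) (\prod_t g t (tnth x t)) = \prod_t \int[mu]_(x in B t) g t x.
Proof.
move=> mB ig Q.
have mQ : measurable Q.
  rewrite (_ : Q = \bigcap_(t in [set: 'I_n]) ((@tnth n R)^~ t @^-1` B t)).
    apply: fin_bigcap_measurable => // t _; rewrite -[X in measurable X]setTI.
    exact: measurable_tnth.
  by apply/seteqP; split=> x /= Bx t; [move=> _|]; exact: Bx.
have gQ : (fun x => \prod_t g t (tnth x t)) \_ Q =
    fun x => \prod_t (g t \_ (B t)) (tnth x t).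
  apply/funext => x; rewrite patchE; case: ifPn => xQ.
    apply: eq_bigr => t _; rewrite patchE ifT//.
    by rewrite inE; move: xQ; rewrite inE; exact.
  have [t Bt] : exists t, ~ B t (tnth x t).
    by apply/existsNP => Bx; move/negP: xQ; apply; rewrite inE.
  by apply/esym/eqP/prodf_eq0; exists t => //; rewrite patchE memNset.
have igB t : mu.-integrable setT (EFin \o (g t \_ (B t))).
  rewrite -restrict_EFin.
  exact: (@integrable_mkcond _ (measurableTypeR R) R mu (B t) _ (mB t)).1 (ig t).
have [iP IP] := integral_prod_Rn igB.
split=> //; split.
  apply/integrable_mkcond => //; rewrite restrict_EFin.
  by move: iP; rewrite -gQ.
rewrite Rintegral_mkcond gQ IP; apply: eq_bigr => t _.
by rewrite [RHS]Rintegral_mkcond.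
Qed.

End product_integrals.

(** * Dyadic rectangles and martingales of measures *)

Section dyadic_rectangles.
Context {R : realType}.
Local Notation mu := (@lebesgue_measure R).

Definition in_dint (J : interval_code) (x : R) : bool :=
  J.2%:R * len J <= x < J.2.+1%:R * len J.

Definition dint (J : interval_code) : set R := [set x | in_dint J x].

Lemma len_child b J : len (child b J) = len J / 2 :> R.
Proof. by rewrite /len exprS mulrC. Qed.

Lemma in_dint_child b J (x : R) : in_dint (child b J) x =
  (J.2%:R * len J + b%:R * (len J / 2) <= x <
   J.2%:R * len J + b.+1%:R * (len J / 2)).
Proof.
rewrite /in_dint len_child /child/= -addSn !natrD -muln2 natrM -[in b.+1%:R]addn1 natrD.
rewrite (_ : _ * _ = J.2%:R * len J + b%:R * (len J / 2)); last by field.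
by rewrite (_ : (_ + b%:R) * _ = J.2%:R * len J + (b%:R + 1) * (len J / 2)); last by field.
Qed.

Lemma in_dint_split J (x : R) :
  in_dint J x = in_dint (child false J) x || in_dint (child true J) x.
Proof.
have itv_split (a l : R) : 0 < l ->
    (a <= x < a + l) = (a <= x < a + l / 2) || (a + l / 2 <= x < a + l).
  move=> l0; have [ax|xa] := leP a x; have [xm|mx] := ltP x (a + l / 2);
    have [xl|lx] := ltP x (a + l) => //=; lra.
rewrite !in_dint_child /in_dint mul0r addr0 mul1r.
rewrite (_ : true.+1%:R * (len J / 2) = len J); last by rewrite mulrC divfK.
rewrite -itv_split ?len_gt0//.
by rewrite -natr1 mulrDl mul1r.
Qed.

Lemma in_dint_disjoint J (x : R) :
  in_dint (child false J) x -> in_dint (child true J) x -> False.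
Proof. by rewrite !in_dint_child mul1r => /andP[_ x1] /andP[x2 _]; lra. Qed.

Lemma dint_itv J : dint J = `[J.2%:R * len J, J.2.+1%:R * len J[%classic.
Proof. by apply/seteqP; split=> x /=; rewrite in_itv. Qed.

Lemma dintE J : dint J = dyadic_interval J.2 (- J.1%:Z).
Proof.
have E : len J = 2 ^ (- J.1%:Z) :> R by rewrite /len exprVn exprnN.
by rewrite dint_itv /dyadic_interval -E intrD -natr1.
Qed.

Lemma measurable_dint J : measurable (dint J).
Proof. by rewrite dint_itv. Qed.

Lemma lebesgue_dint J : mu (dint J) = (len J)%:E.
Proof.
rewrite dint_itv lebesgue_measure_itv/= lte_fin ltr_pM2r ?len_gt0// ltr_nat ltnSn.
by rewrite -EFinB -mulrBl -natrB// subSnn mul1r.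
Qed.

Context (d : nat).
Implicit Types (s : seq interval_code) (x : d.-tuple R) (t : 'I_d).

Local Notation side s t := (nth (0, 0)%N s t).

(** Sides beyond the length of s default to (0, 0), that is to [0, 1); thus
    [rect [::]] is the half-open unit cube and codes need no size condition. *)
Definition rect s : set (d.-tuple R) := [set x | forall t, in_dint (side s t) (tnth x t)].

Definition rect_volume s : R := \prod_(t < d) len (side s t).

Lemma rect_volume_gt0 s : 0 < rect_volume s.
Proof. by apply: prodr_gt0 => t _; exact: len_gt0. Qed.

Lemma rect_volumeE s : size s = d -> rect_volume s = volume s.
Proof.
by move=> sd; rewrite /volume (big_nth (0, 0)%N) sd big_mkord.
Qed.

Lemma lebesgue_rect s : lebesgueRn d (rect s) = (rect_volume s)%:E.
Proof.
rewrite (lebesgueRn_box (fun t => measurable_dint (side s t))).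
by rewrite -prodEFin; apply: eq_bigr => t _; exact: lebesgue_dint.
Qed.

Lemma measurable_rect s : measurable (rect s).
Proof.
rewrite (_ : rect s =
    \bigcap_(t in [set: 'I_d]) ((@tnth d R)^~ t @^-1` dint (side s t))).
  apply: fin_bigcap_measurable => // t _; rewrite -[X in measurable X]setTI.
  by apply: measurable_tnth => //; exact: measurable_dint.
by apply/seteqP; split=> x /= Bx t; [move=> _|]; exact: Bx.
Qed.

Lemma dyadic_rect s : dyadic_rectangle (rect s).
Proof.
exists (fun t => (side s t).2), (fun t => (- (side s t).1%:Z)).
by apply/seteqP; split=> x /= sx t; have := sx t; rewrite -dintE.
Qed.

Lemma side_cat s1 J s2 t : side (s1 ++ J :: s2) t =
  if t == size s1 :> nat then J else side (s1 ++ (0, 0)%N :: s2) t.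
Proof.
rewrite !nth_cat; case: eqP => [->|/eqP ts]; first by rewrite ltnn subnn.
case: ltnP => // st; move: ts; rewrite neq_ltn ltnNge st/= => st'.
by case E : (t - size s1)%N => [|k]//; move/eqP: E; rewrite subn_eq0 leqNgt st'.
Qed.

(** Beyond the first d entries f is constant, so that the mean over the two children
    changes nothing. *)
Lemma martingale_coord (f : seq interval_code -> R) :
  (forall s s', (forall t, side s t = side s' t) -> f s = f s') ->
  (forall s1 J s2, (size s1 < d)%N ->
    f (s1 ++ J :: s2) = mean2 (fun K => f (s1 ++ K :: s2)) J) ->
  martingale f.
Proof.
move=> fE mf s1 J s2; have [s1d|ds1] := ltnP (size s1) d; first exact: mf.
have cE K : f (s1 ++ K :: s2) = f (s1 ++ J :: s2).
  apply: fE => t; rewrite side_cat [RHS]side_cat; case: eqP => // ts.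
  by have := ltn_ord t; rewrite ts ltnNge ds1.
by rewrite /mean2 !cE; field.
Qed.

(** A rectangle is the disjoint union of its two halves in a given direction, each
    of half its volume.  This serves twice: for Lebesgue measure restricted to the
    good set, and for Dirac masses, which count the rectangles that contain a
    point. *)
Lemma martingale_measure (nu : {measure set (d.-tuple R) -> \bar R}) :
  (nu setT < +oo)%E -> martingale (fun s => fine (nu (rect s)) / rect_volume s).
Proof.
move=> fin_nu; apply: martingale_coord => [s s' ss'|s1 J s2 s1d].
  by congr (fine (nu _) / _); [apply/seteqP; split=> x /= sx t; have := sx t; rewrite ss'|
    apply: eq_bigr => t _; rewrite ss'].
pose t0 := Ordinal s1d; pose S K := s1 ++ K :: s2.
have S0 K : side (S K) t0 = K by rewrite side_cat eqxx.
have SN K t : t != t0 -> side (S K) t = side (S J) t.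
  move=> tt0; have /negbTE ts : nat_of_ord t != size s1 by exact: tt0.
  by rewrite side_cat [RHS]side_cat ts.
pose W : R := \prod_(t < d | t != t0) len (side (S J) t).
have W0 : W != 0 by rewrite gt_eqF// prodr_gt0// => t _; exact: len_gt0.
have volS K : rect_volume (S K) = len K * W.
  rewrite /rect_volume (bigD1 t0)//= S0; congr (_ * _).
  by apply: eq_bigr => t tt0; rewrite SN.
have inS K x : rect (S K) x <-> in_dint K (tnth x t0) /\
    (forall t, t != t0 -> in_dint (side (S J) t) (tnth x t)).
  split=> [Kx|[K0 KN] t].
    by split=> [|t tt0]; [rewrite -(S0 K)|rewrite -(SN K)//]; exact: Kx.
  by have [->|tt0] := eqVneq t t0; rewrite ?S0// SN//; exact: KN.
have finnu A : measurable A -> nu A \is a fin_num.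
  move=> mA; rewrite ge0_fin_numE//; apply: le_lt_trans fin_nu.
  by rewrite le_measure ?inE.
have E : nu (rect (S J)) = (nu (rect (S (child false J))) + nu (rect (S (child true J))))%E.
  rewrite -measureU; [|exact: measurable_rect|exact: measurable_rect|].
    congr (nu _); apply/seteqP; split=> x /=.
      by move=> /inS[]; rewrite in_dint_split => /orP[] Kx Nx; [left|right]; apply/inS.
    by case=> /inS[Kx Nx]; apply/inS; rewrite in_dint_split Kx ?orbT.
  by apply/seteqP; split=> x //= [/inS[x0 _] /inS[x1 _]]; exact: in_dint_disjoint x0 x1.
rewrite -/(S J) E fineD ?finnu//; try exact: measurable_rect.
rewrite /mean2 -/(S _) -/(S _) !volS !len_child.
by have := @len_gt0 R J => l0; field; rewrite W0 gt_eqF.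
Qed.

End dyadic_rectangles.

(** * The mean-free discrepancy as a sum of products *)

Section mean_free_discrepancy.
Context {R : realType} (d : nat).
Local Notation mu := (@lebesgue_measure R).
Local Notation side s t := (nth (0, 0)%N s t).

Definition mean01 (h : R -> R) : R := \int[mu]_(y in `[0, 1]) h y.

(** Each [Id - Int t] acts on a product of one-variable functions by subtracting its
    mean from the factor of index t. *)
Lemma IdInt_sum_prod (O : Type) (os : seq O) (c : O -> R)
    (g : O -> 'I_d -> R -> R) (r : seq 'I_d) : uniq r ->
  (forall o t, mu.-integrable `[0, 1] (EFin \o g o t)) ->
  (\big[comp/id]_(t <- r) (fun f => f \- Int t f))
    (fun x : d.-tuple R => \sum_(o <- os) c o * \prod_t g o t (tnth x t)) =
  (fun x => \sum_(o <- os) c o *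
     \prod_t (g o t (tnth x t) - (t \in r)%:R * mean01 (g o t))).
Proof.
move=> + ig; elim: r => [_|t r IH /= /andP[tr ur]].
  rewrite big_nil; apply/funext => x; apply: eq_bigr => o _; congr (_ * _).
  by apply: eq_bigr => t _; rewrite mul0r subr0.
rewrite big_cons /= IH//; apply/funext => x; rewrite /= /Int.
pose h o i y := g o i y - (i \in r)%:R * mean01 (g o i).
have E o y : \prod_i h o i (tnth (set_coord x t y) i) =
    (\prod_(i | i != t) h o i (tnth x i)) * g o t y.
  rewrite (bigD1 t)//= tnth_mktuple eqxx /h (negbTE tr) mul0r subr0 mulrC.
  by congr (_ * _); apply: eq_bigr => i /negbTE it; rewrite tnth_mktuple it.
under eq_Rintegral => y _.
  under eq_bigr => o _ do rewrite -/(h o _) E mulrA.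
  over.
rewrite Rintegral_linear_sum// -sumrB; apply: eq_bigr => o _.
rewrite -/(mean01 _) -mulrA -mulrBr; congr (_ * _).
rewrite (bigD1 t)//= [RHS](bigD1 t)//= (negbTE tr) inE eqxx/= mul0r subr0 mul1r.
rewrite -/(h _ _ _) [RHS]mulrBl [_ * mean01 _]mulrC; congr (_ * _ - _ * _);
  by apply: eq_bigr => i /negbTE it; rewrite inE it.
Qed.

(** The discrepancy function is the sum, over the points a, of the indicators of
    {x : a_t < x_t for all t}, minus N times the product of the coordinates.  The
    index [None] stands for the last term; the positive part of the coordinate makes
    it the volume of the box for every x, outside of the cube as well. *)
Definition term_factor (o : option (d.-tuple R)) (t : 'I_d) (y : R) : R :=
  if o is Some a then (tnth a t < y)%R%:R else Num.max 0 y.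

Definition term_coef (N : nat) (o : option (d.-tuple R)) : R :=
  if o is Some _ then 1 else - N%:R.

Lemma discrepancy_sum (A : {fset d.-tuple R}) :
  [set` A] `<=` @unit_cube R d ->
  discrepancy A = fun x => \sum_(o <- None :: [seq Some a | a <- enum_fset A])
    term_coef #|` A| o * \prod_t term_factor o t (tnth x t).
Proof.
move=> A01; apply/funext => x; rewrite big_cons big_map addrC /discrepancy /=.
congr (_ + _); last first.
  rewrite mulNr; congr (- (_ * _)).
  rewrite (_ : origin_box x = [set y | forall t, `[0, tnth x t[%classic (tnth y t)]).
    rewrite (lebesgueRn_box (fun t => measurable_itv _)).
    rewrite (eq_bigr (fun t => (Num.max 0 (tnth x t))%:E)) ?prodEFin// => t _.
    by rewrite lebesgue_measure_itv/= lte_fin sube0 /Num.max; case: ifP.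
  by apply/seteqP; split=> y /= yx t; have := yx t; rewrite in_itv.
rewrite card_fset_sum1 natr_sum big_fset big_mkcond/=.
apply: eq_big_seq => a aA; have a01 := A01 a aA; rewrite mul1r.
have [ax|ax] := boolP (a \in origin_box x); rewrite /=.
  rewrite big1// => t _.
  by move: ax; rewrite inE => /(_ t) /andP[_ ->].
apply/esym/eqP/prodf_eq0.
move: ax; rewrite notin_setE => /existsNP[t axt]; exists t => //.
have [xa|ax] := leP (tnth x t) (tnth a t); rewrite ?eqxx//.
by exfalso; apply: axt; rewrite ax andbT; have /andP[] := a01 t.
Qed.

Lemma integrable_term_factor o t (D : set R) (a b : R) :
  measurable D -> D `<=` `[a, b] -> mu.-integrable D (EFin \o term_factor o t).
Proof.
move=> mD Dab; apply: (@integrableS _ (measurableTypeR R) R mu `[a, b] D _ _ mD Dab) => //.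
case: o => [x|] /=; last first.
  apply: continuous_compact_integrable; first exact: segment_compact.
  apply: continuous_subspaceT => y.
  by apply: continuous_max => //; exact: cst_continuous.
rewrite (_ : term_factor _ t = \1_`]tnth x t, +oo[); last first.
  by apply/funext => y; rewrite indicE /term_factor mem_setE in_itv/= andbT.
apply: measurable_bounded_integrable => //.
  by rewrite [ltLHS]lebesgue_measure_itv/=; case: ifPn => //; rewrite -EFinB ltry.
exists 1; split=> // M M1 y _ /=; apply: le_trans (ltW M1).
by rewrite indicE; case: (_ \in _); rewrite ?normr1 ?normr0.
Qed.
End mean_free_discrepancy.

(** * Averages and Haar coefficients of the mean-free discrepancy *)

Section tilde_coefficients.
Context {R : realType} (d : nat).
Local Notation mu := (@lebesgue_measure R).
Local Notation side s t := (nth (0, 0)%N s t).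
Implicit Types (J K : interval_code) (s : seq interval_code).

Definition mean_on (g : R -> R) J : R := (len J)^-1 * \int[mu]_(y in dint J) g y.

Lemma dintU J : dint J = dint (child false J) `|` dint (child true J) :> set R.
Proof.
apply/seteqP; split=> x; rewrite /setU /dint /mkset (in_dint_split J); first by move=> /orP.
by move=> ?; exact/orP.
Qed.

Lemma mean_on_martingale (g : R -> R) J : mu.-integrable (dint J) (EFin \o g) ->
  mean_on g J = mean2 (mean_on g) J.
Proof.
move=> ig; rewrite /mean_on /mean2 !len_child dintU Rintegral_setU.
- by have l0 := @len_gt0 R J; field; rewrite gt_eqF.
- exact: measurable_dint.
- exact: measurable_dint.
- by rewrite -dintU.
- by apply/disj_setPS => x [/= x0 x1]; exact: in_dint_disjoint x0 x1.
Qed.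

Lemma Rintegral_dint_cst J (g : R -> R) k : (forall y, dint J y -> g y = k) ->
  \int[mu]_(y in dint J) g y = k * len J.
Proof.
move=> gk; rewrite (@eq_Rintegral _ _ _ _ _ (cst k)); last first.
  by move=> y; rewrite inE => /gk.
rewrite Rintegral_cst; last exact: measurable_dint.
by rewrite [X in fine X]lebesgue_dint.
Qed.

Lemma mean_on_cst J (g : R -> R) k : (forall y, dint J y -> g y = k) ->
  mean_on g J = k.
Proof.
by move=> gk; rewrite /mean_on (Rintegral_dint_cst gk) mulrC mulfK// gt_eqF// len_gt0.
Qed.

Lemma dint_child b J : (dint (child b J) : set R) `<=` dint J.
Proof. by rewrite [dint J]dintU => x; case: b; [right|left]. Qed.

(** Outside of the interval that contains its jump a step function is constant. *)
Lemma haar_mean_on_jump (a : R) J : ~~ in_dint J a ->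
  haar (mean_on (fun y => (a < y)%R%:R)) J = 0.
Proof.
move=> aJ; suff [k gk] : exists k, forall y, dint J y -> (a < y)%R%:R = k :> R.
  rewrite /haar !(@mean_on_cst _ _ k) ?subrr ?mul0r// => y /dint_child; exact: gk.
move: aJ; rewrite /in_dint negb_and -ltNge -leNgt => /orP[aJ|Ja].
  by exists 1 => y /andP[Jy _]; rewrite (lt_le_trans aJ).
by exists 0 => y /andP[_ yJ]; rewrite ltNge (le_trans (ltW yJ)).
Qed.

Lemma Rintegral_max0 (a b : R) : 0 <= a < b ->
  \int[mu]_(y in `[a, b[) Num.max 0 y = (b ^+ 2 - a ^+ 2) / 2.
Proof.
move=> /andP[a0 ab].
rewrite Rintegral_itv_bndo_bndc; last first.
  apply: (@integrableS _ (measurableTypeR R) R mu `[a, b]) => //.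
    by apply: subset_itvl; rewrite bnd_simp.
  apply: continuous_compact_integrable; first exact: segment_compact.
  apply: continuous_subspaceT => y.
  by apply: continuous_max => //; exact: cst_continuous.
transitivity (\int[mu]_(y in `[a, b]) y).
  apply: eq_Rintegral => y; rewrite inE/= in_itv/= => /andP[ay _].
  by apply/max_idPr; exact: le_trans ay.
have dF (y : R) : is_derive y 1 (fun y => y ^+ 2 / 2) y.
  by apply: is_derive_eq; rewrite /GRing.scale/=; field.
have cF : continuous (fun y : R => y ^+ 2 / 2).
  by move=> y; apply: differentiable_continuous; apply/derivable1_diffP; case: (dF y).
rewrite /Rintegral (@continuous_FTC2 _ _ (fun y => y ^+ 2 / 2))//=.
- by rewrite -mulrBl.
- by apply: continuous_subspaceT => y; exact: cvg_id.
- split=> [y _||]; first by case: (dF y).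
  + by apply: cvg_at_right_filter; exact: cF.
  + by apply: cvg_at_left_filter; exact: cF.
- by move=> y _; rewrite derive1E; exact: derive_val.
Qed.

Lemma mean_on_max0 J : mean_on (Num.max 0) J = (J.2%:R + 2^-1) * len J.
Proof.
rewrite /mean_on dint_itv Rintegral_max0; last first.
  by rewrite mulr_ge0 ?len_ge0//= ltr_pM2r ?len_gt0// ltr_nat.
by rewrite -natr1; have l0 := @len_gt0 R J; field; rewrite gt_eqF.
Qed.

Lemma haar_mean_on_max0 J : haar (mean_on (Num.max 0)) J = len J / 4.
Proof.
rewrite /haar !mean_on_max0 !len_child /child/= addn0 addn1 -natr1; by field.
Qed.

(** A tensor product of functions has tensor product Haar coefficients. *)
Lemma mixed_haar_prod n (phi : 'I_n -> interval_code -> R) s : size s = n ->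
  mixed_haar s (fun q => \prod_t phi t (side q t)) = \prod_t haar (phi t) (side s t).
Proof.
elim: n phi s => [|n IH] phi [|J s]//= => [_|[sn]]; first by rewrite !big_ord0.
rewrite big_ord_recl -(IH (fun t => phi (lift ord0 t)))//=.
transitivity (mixed_haar s (fun q => haar (phi ord0) J *
   \prod_(t < n) phi (lift ord0 t) (side q t) + 0 * 0)); last first.
  by rewrite mixed_haar_lin mul0r addr0.
congr mixed_haar; apply/funext => q.
by rewrite mul0r addr0 /haar !big_ord_recl/=; field.
Qed.

Lemma mixed_haar_sum (O : Type) (os : seq O) (c : O -> R)
    (f : O -> seq interval_code -> R) s :
  mixed_haar s (fun q => \sum_(o <- os) c o * f o q) =
  \sum_(o <- os) c o * mixed_haar s (f o).
Proof.
elim: os => [|o os IH].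
  rewrite big_nil; transitivity (mixed_haar s (fun q => 0 * 0 + 0 * 0 : R)).
    by congr mixed_haar; apply/funext => q; rewrite big_nil mul0r addr0.
  by rewrite mixed_haar_lin !mul0r addr0.
rewrite big_cons -IH -[X in _ + X]mul1r -mixed_haar_lin; congr mixed_haar.
by apply/funext => q; rewrite big_cons mul1r.
Qed.

Definition cube_code s : Prop := forall t : 'I_d, ((side s t).2 < 2 ^ (side s t).1)%N.

Lemma lenE J : len J = (2 ^ J.1)%:R^-1 :> R.
Proof. by rewrite /len exprVn natrX. Qed.

Lemma dint_cube J : (J.2 < 2 ^ J.1)%N -> (dint J : set R) `<=` `[0, 1[.
Proof.
move=> Jlt y /andP[Jy yJ]; rewrite /= in_itv/=; apply/andP; split.
  by apply: le_trans Jy; rewrite mulr_ge0// len_ge0.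
apply: lt_le_trans yJ _.
by rewrite lenE ler_pdivrMr ?mul1r ?ler_nat// ltr0n expn_gt0.
Qed.

Lemma dint_outside J (y : R) : (2 ^ J.1 <= J.2)%N -> dint J y -> 1 <= y.
Proof.
move=> Jge /andP[Jy _]; apply: le_trans Jy.
by rewrite lenE ler_pdivlMr ?mul1r ?ler_nat// ltr0n expn_gt0.
Qed.

(** The average over [rect s] of the mean-free discrepancy before its extension by
    zero.  Unlike the average of the extended function, this formula is a product
    in the sides of s for every code s, hence a martingale at once; the two agree
    inside the unit cube. *)
Definition tilde_average (A : {fset d.-tuple R}) s : R :=
  \sum_(o <- None :: [seq Some a | a <- enum_fset A])
    term_coef #|` A| o * \prod_(t < d) (mean_on (term_factor o t) (side s t) - mean01 (term_factor o t)).

Lemma integrable_term_factor_dint (o : option (d.-tuple R)) (t : 'I_d) J :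
  mu.-integrable (dint J) (EFin \o (term_factor o t : R -> R)).
Proof.
apply: (@integrable_term_factor _ _ _ _ _ (J.2%:R * len J) (J.2.+1%:R * len J)).
  exact: measurable_dint.
by rewrite dint_itv; apply: subset_itvl; rewrite bnd_simp.
Qed.

Lemma integrable_dint_cst J (k : R) : mu.-integrable (dint J) (EFin \o cst k).
Proof.
apply: (@measurable_bounded_integrable _ (measurableTypeR R) R mu).
- exact: measurable_dint.
- by rewrite [ltLHS]lebesgue_dint ltry.
- exact: measurable_cst.
- exact: bounded_cst.
Qed.

Lemma average_tilde (A : {fset d.-tuple R}) s : [set` A] `<=` @unit_cube R d ->
  cube_code s -> average (rect s) (tilde_discrepancy A) = tilde_average A s.
Proof.
move=> A01 cs; rewrite /average.
have i01 (o : option (d.-tuple R)) t : mu.-integrable `[0, 1] (EFin \o (term_factor o t : R -> R)).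
  exact: (@integrable_term_factor _ _ _ _ _ 0 1).
set os := None :: [seq Some a | a <- enum_fset A].
have -> : \int[lebesgueRn d]_(y in rect s) tilde_discrepancy A y =
    \int[lebesgueRn d]_(y in rect s) \sum_(o <- os)
     term_coef #|` A| o * \prod_t (term_factor o t (tnth y t) - mean01 (term_factor o t)).
  apply: eq_Rintegral => y; rewrite inE => sy.
  rewrite /tilde_discrepancy patchE ifT; last first.
    rewrite inE => t; have := dint_cube (cs t) (sy t).
    by rewrite /= in_itv/= => /andP[-> /ltW ->].
  rewrite mean_free_discrepancyE// discrepancy_sum// IdInt_sum_prod//; last first.
    exact: index_enum_uniq.
  apply: eq_bigr => o _; congr (_ * _); apply: eq_bigr => t _.
  by rewrite mem_index_enum mul1r.
have ig (o : option (d.-tuple R)) (t : 'I_d) : mu.-integrable (dint (side s t))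
    (EFin \o (fun y : R => term_factor o t y - mean01 (term_factor o t))).
  rewrite (_ : _ \o _ = fun y => (EFin \o (term_factor o t : R -> R)) y -
    (EFin \o cst (mean01 (term_factor o t))) y)%E//.
  apply: integrableB; [exact: measurable_dint|exact: integrable_term_factor_dint|].
  exact: integrable_dint_cst.
have box o := integral_prod_box (fun t => measurable_dint (side s t)) (ig o).
rewrite Rintegral_linear_sum; last 2 first.
- by have [] := box None.
- by move=> o; have [_ []] := box o.
rewrite /tilde_average -/os mulr_sumr; apply: eq_bigr => o _.
have [_ [_ ->]] := box o; rewrite mulrCA; congr (_ * _).
rewrite [X in fine X]lebesgue_rect /= /rect_volume -prodfV -big_split/=.
apply: eq_bigr => t _; rewrite RintegralB; last 3 first.
- exact: measurable_dint.
- exact: integrable_term_factor_dint.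
- exact: integrable_dint_cst.
rewrite [X in _ - X](Rintegral_dint_cst (k := mean01 (term_factor o t)))// mulrBr /mean_on.
by congr (_ - _); rewrite mulrC mulfK// gt_eqF// len_gt0.
Qed.

Lemma martingale_tilde (A : {fset d.-tuple R}) : martingale (tilde_average A).
Proof.
apply: (@martingale_coord R d) => [s s' ss'|s1 J s2 s1d].
  by apply: eq_bigr => o _; congr (_ * _); apply: eq_bigr => t _; rewrite ss'.
rewrite /mean2 /tilde_average -big_split mulr_suml/=; apply: eq_bigr => o _.
rewrite -mulrDr -mulrA; congr (_ * _).
pose t0 := Ordinal s1d; pose phi t J := mean_on (term_factor o t) J - mean01 (term_factor o t).
have prodE K : \prod_(t < d) phi t (side (s1 ++ K :: s2) t) =
    phi t0 K * \prod_(t < d | t != t0) phi t (side (s1 ++ J :: s2) t).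
  rewrite (bigD1 t0)//= nth_cat ltnn subnn/=; congr (_ * _).
  apply: eq_bigr => t tt0; rewrite side_cat [in RHS]side_cat.
  by have /negbTE -> : nat_of_ord t != size s1 by exact: tt0.
rewrite !prodE -mulrDl mulrAC; congr (_ * _).
rewrite /phi (mean_on_martingale (integrable_term_factor_dint o t0 J)) /mean2.
by field.
Qed.

(** The constants [mean01] disappear under differences.  A point a outside of the
    rectangle is outside of one of its sides, and the factor of that direction has
    no Haar coefficient there.  Only the volume term is left; the half-difference of
    the means of the identity over the two halves of an interval is a quarter of
    its length. *)
Lemma mixed_haar_tilde (A : {fset d.-tuple R}) s : size s = d ->
  (forall a, a \in A -> ~ rect s a) ->
  mixed_haar s (tilde_average A) = - (#|` A|%:R * rect_volume d s / 4 ^+ d).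
Proof.
move=> sd As; rewrite mixed_haar_sum.
under eq_bigr => o _ do
  rewrite (mixed_haar_prod (fun t J => mean_on (term_factor o t) J - mean01 (term_factor o t)))//.
have haarE (o : option (d.-tuple R)) t J : haar (fun K => mean_on (term_factor o t) K - mean01 (term_factor o t)) J =
    haar (mean_on (term_factor o t)) J.
  by rewrite /haar; congr (_ / _); ring.
rewrite big_cons big_map [X in _ + X]big1_seq ?addr0; last first.
  move=> a /= aA; rewrite mul1r; apply/eqP/prodf_eq0.
  have [t at_] : exists t : 'I_d, ~ in_dint (side s t) (tnth a t).
    by apply/existsNP; exact: As.
  by exists t => //; rewrite haarE haar_mean_on_jump//; exact/negP.
rewrite /term_coef mulNr -mulrA; congr (- (_ * _)).
under eq_bigr do rewrite haarE haar_mean_on_max0.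
by rewrite big_split/= prodr_const card_ord exprVn.
Qed.
End tilde_coefficients.

(** * From a large maximal function to a large norm *)

Section lower_bound.
Context {R : realType} (d : nat).
Implicit Types (s q : seq interval_code).

(** Monotonicity of the integral of nonnegative functions without measurability,
    directly from the supremum over simple functions: it spares the proof that the
    dyadic maximal function is measurable. *)
Lemma le_integralT e (T : measurableType e) (nu : {measure set T -> \bar R})
    (f g : T -> \bar R) : (forall x, 0 <= f x)%E -> (forall x, f x <= g x)%E ->
  (\int[nu]_x f x <= \int[nu]_x g x)%E.
Proof.
move=> f0 fg; have g0 x : (0 <= g x)%E by exact: le_trans (fg x).
rewrite !ge0_integralTE//; apply: le_ereal_sup => _ [h hf <-].
by exists h => // x; exact: le_trans (hf x) (fg x).
Qed.

(** Chebyshev's inequality. *)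
Lemma hardy_norm_ge (f : d.-tuple R -> R) (p lam a : R) (E : set (d.-tuple R)) :
  0 < p -> 0 <= lam -> 0 <= a -> measurable E -> (a%:E <= lebesgueRn d E)%E ->
  (forall x, E x -> (lam%:E <= dyadic_maximal f x)%E) ->
  ((lam * a `^ p^-1)%:E <= hardy_norm p f)%E.
Proof.
move=> p0 lam0 a0 mE aE lamf; rewrite /hardy_norm unlock.
have : ((lam `^ p * a)%:E <= \int[lebesgueRn d]_x (`|dyadic_maximal f x| `^ p))%E.
  apply: (@le_trans _ _ (\int[lebesgueRn d]_x ((lam `^ p)%:E * (\1_E x)%:E))%E).
    rewrite ge0_integralZl//; last 2 first.
    - by apply/measurable_EFinP; exact: measurable_indic.
    - by rewrite lee_fin powR_ge0.
    rewrite integral_indic// setIT EFinM; apply: lee_wpmul2l => //.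
    by rewrite lee_fin powR_ge0.
  apply: le_integralT => x.
    by rewrite mule_ge0 ?lee_fin ?powR_ge0.
  rewrite indicE; case: (boolP (x \in E)) => xE /=; last by rewrite mule0 poweR_ge0.
  rewrite mule1 -poweR_EFin; apply: gt0_ler_poweR; first exact: ltW.
  - by rewrite in_itv/= lee_fin lam0 leey.
  - by rewrite in_itv/= abse_ge0 leey.
  by apply: le_trans (lee_abs _); apply: lamf; rewrite inE in xE.
move=> /(@gt0_ler_poweR _ p^-1); rewrite !in_itv/= !leey !andbT.
rewrite invr_ge0 (ltW p0) lee_fin mulr_ge0 ?powR_ge0// => /(_ isT isT).
rewrite integral_ge0//; last by move=> x _; exact: poweR_ge0.
move=> /(_ isT); apply: le_trans.
by rewrite lee_fin powRM ?powR_ge0// -powRrM mulfV ?gt_eqF// powRr1.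
Qed.

(** * Counting codes and level vectors *)

Lemma refines_rect q s : refines q s -> @rect R d q `<=` @rect R d s.
Proof.
move=> qs x qx t; move: (qx t); move: (nat_of_ord t) (tnth x t) => {qx x}n y.
elim: q s n qs => [|K q IH] [|J s] n//= /andP[KJ qs].
case: n => [|n]/=; last exact: IH.
case/or3P: KJ => /eqP ->// Ky; by rewrite (in_dint_split J) Ky ?orbT.
Qed.

Lemma rect_outside s x : @rect R d s x -> @rect R d [::] x -> cube_code d s.
Proof.
move=> sx x01 t; rewrite ltnNge; apply/negP => Jge.
have := dint_outside Jge (sx t); have := x01 t; rewrite nth_nil => /(@dint_cube R (0, 0)%N)/=; rewrite in_itv/=.
by move=> /(_ isT) /andP[_ x1]; rewrite leNgt x1.
Qed.

Lemma unzip1_layer (r : seq nat) s : s \in layer r -> unzip1 s = r.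
Proof.
elim: r s => [|j r IH] s /=; first by rewrite inE => /eqP ->.
by move=> /allpairsP[[J q]/= [/mapP[i _ ->] /IH qr ->]]; rewrite /= qr.
Qed.

Lemma volume_layer (r : seq nat) s : s \in layer r ->
  volume s = 2^-1 ^+ sumn r :> R.
Proof.
move=> /unzip1_layer <-; elim: s => [|J s IH].
  by rewrite /volume big_nil expr0.
by rewrite /volume big_cons /= exprD -IH.
Qed.

Lemma words_level m k : words (level m) k = layer (nseq k m).
Proof. by elim: k => [//|k IH] /=; rewrite IH. Qed.

Lemma size_words (T : eqType) (L : seq T) k x : x \in words L k -> size x = k.
Proof.
elim: k x => [|k IH] x /=; first by rewrite inE => /eqP ->.
by move=> /allpairsP[[y q]/= [_ /IH <- ->]].
Qed.

Lemma mem_words (T : eqType) (L x : seq T) : all (mem L) x -> x \in words L (size x).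
Proof.
elim: x => [//|y x IH] /= /andP[yL xL].
by apply/allpairsP; exists (y, x) => /=; split=> //; exact: IH.
Qed.

Lemma ffact_ge n k : (n ^ k <= (k + n) ^_ k)%N.
Proof.
elim: k => [//|k IH]; rewrite expnS ffactnS addSn /= leq_mul//.
by rewrite -addSn leq_addl.
Qed.

(** There are 'C(n + k, k) vectors of k + 1 natural numbers with sum n, by
    [card_ord_partitions], and k! 'C(n + k, k) is a product of k factors larger
    than n. *)
Lemma count_words_sum n k :
  (n ^ k <= k`! * count (fun r => sumn r == n) (words (iota 0 n.+1) k.+1))%N.
Proof.
apply: leq_trans (ffact_ge n k) _; rewrite -bin_ffact mulnC leq_mul2l; apply/orP; right.
rewrite -card_ord_partitions cardE -(size_map (fun t : k.+1.-tuple 'I_n.+1 => map val t)).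
rewrite -size_filter; apply: uniq_leq_size.
  rewrite map_inj_uniq ?enum_uniq// => t t' tt'.
  by apply: val_inj; apply: (inj_map val_inj).
move=> x /mapP[t]; rewrite mem_enum inE => /eqP tn ->.
rewrite mem_filter sumnE big_map tn eqxx andTb.
have := @mem_words _ (iota 0 n.+1) (map val t); rewrite size_map size_tuple; apply.
by apply/allP => _ /mapP[i _ ->]; rewrite -[_ (val i)]/(val i \in iota 0 n.+1) mem_iota add0n ltn_ord.
Qed.

End lower_bound.

(** * The contribution of the empty rectangles *)

Section energy.
Context {R : realType} (d : nat).
Implicit Types (s : seq interval_code) (A : {fset d.-tuple R}).

Lemma rect_nseq0 k : @rect R d (nseq k (0, 0)%N) = @rect R d [::].
Proof.
by apply/seteqP; split=> x sx t; have := sx t; rewrite nth_nil nth_nseq if_same.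
Qed.

Lemma rect_volume_nseq0 k : rect_volume d (nseq k (0, 0)%N) = 1 :> R.
Proof.
by rewrite /rect_volume big1// => t _; rewrite nth_nseq if_same /len expr0.
Qed.

Lemma wsum_layer1 r : wsum volume (layer r) (fun=> 1) = 1 :> R.
Proof.
by rewrite (@wsum_layer_martingale R (fun=> 1))// => s1 J s2; rewrite /mean2; field.
Qed.

(** The rectangles of a layer are disjoint, so a is in at most one of them.  Here this
    is the martingale property of the Dirac mass at a: all rectangles of the layer
    have the same volume 2^-n. *)
Lemma wsum_layer_point (a : d.-tuple R) r : size r = d ->
  wsum volume (layer r) (fun s => \1_(@rect R d s) a) <= 2^-1 ^+ sumn r :> R.
Proof.
move=> rd; pose nu : {measure set (d.-tuple R) -> \bar R} := dirac a.
have fin_nu : (nu setT < +oo)%E by rewrite /= diracE ltry.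
have mnu := martingale_measure fin_nu.
have nuE X : fine (nu X) = \1_X a :> R by [].
have -> : wsum volume (layer r) (fun s => \1_(@rect R d s) a) =
    2^-1 ^+ sumn r * wsum volume (layer r) (fun s => fine (nu (rect s)) / rect_volume d s) :> R.
  rewrite -wsumZ; apply: eq_big_seq => s sr; congr (_ * _).
  rewrite rect_volumeE; last by rewrite -rd -(unzip1_layer sr) size_map.
  by rewrite (volume_layer sr) nuE mulrCA mulfV ?mulr1.
rewrite (wsum_layer_martingale r mnu) rect_volume_nseq0 nuE indicE divr1.
by rewrite ger_pMr ?exprn_gt0 ?invr_gt0//; case: (_ \in _).
Qed.

(** The rectangles that contain points have total volume at most N 2^-n <= 1/2, so
    that the empty ones retain at least 3/4 - 1/2 of the mean of v.  On these the Haar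
    coefficient is at least K = 1 / (4^d 4) in absolute value. *)
Lemma layer_energy A v r n : (2 * #|` A| <= 2 ^ n <= 4 * #|` A|)%N ->
  size r = d -> sumn r = n -> martingale v -> (forall s, 0 <= v s <= 1) ->
  3 / 4 <= v (nseq d (0, 0)%N) ->
  (4 ^+ d * 4)^-1 ^+ 2 / 16 <=
  wsum volume (layer r) (fun s => mixed_haar s (tilde_average A) ^+ 2 * v s ^+ 2).
Proof.
move=> /andP[Nn nN] rd rn mv v01 v0; set N := #|` A| in Nn nN.
pose K : R := (4 ^+ d * 4)^-1.
pose hit s : R := \sum_(a <- enum_fset A) \1_(@rect R d s) a.
have hit0 s : 0 <= hit s by apply: sumr_ge0 => a _; rewrite indicE.
(* v^2 >= v/2 - 1/16 is linear in v, so it can be averaged over the layer; the mean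
   of the bracket is at least 3/8 - 1/16 - 1/4 = 1/16.  The term hit/2 makes the
   bracket nonpositive on the rectangles that contain points, as v <= 1. *)
have lower s : s \in layer r ->
    K ^+ 2 * (v s / 2 - 1 / 16 - hit s / 2) <=
    mixed_haar s (tilde_average A) ^+ 2 * v s ^+ 2.
  move=> sr; have /andP[vs0 vs1] := v01 s.
  have sd : size s = d by rewrite -rd -(unzip1_layer sr) size_map.
  have [As|/existsNP[a /not_implyP[aA sa]]] := pselect (forall a, a \in A -> ~ rect s a).
    rewrite mixed_haar_tilde// sqrrN rect_volumeE// (volume_layer sr) rn -/N.
    have Kle : K <= N%:R * 2^-1 ^+ n / 4 ^+ d.
      rewrite /K invfM mulrC ler_wpM2r ?invr_ge0 ?exprn_ge0//.
      rewrite exprVn ler_pdivlMr ?exprn_gt0// mulrC ler_pdivrMr//.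
      by rewrite -natrX -natrM ler_nat mulnC.
    have K0 : 0 <= K by rewrite invr_ge0 mulr_ge0// exprn_ge0.
    have K2le : K ^+ 2 <= (N%:R * 2^-1 ^+ n / 4 ^+ d) ^+ 2.
      by rewrite lerXn2r ?nnegrE// (le_trans K0).
    apply: (@le_trans _ _ (K ^+ 2 * v s ^+ 2)); last by rewrite ler_wpM2r// sqr_ge0.
    rewrite ler_wpM2l ?sqr_ge0//.
    have := sqr_ge0 (v s - 1 / 4); have := hit0 s.
    by rewrite (_ : (v s - 1 / 4) ^+ 2 = v s ^+ 2 - v s / 2 + 1 / 16); [lra|field].
  apply: (@le_trans _ _ 0); last by rewrite mulr_ge0 ?sqr_ge0.
  rewrite mulr_ge0_le0 ?sqr_ge0//.
  have : 1 <= hit s.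
    rewrite /hit (big_rem a)//= indicE mem_set; last by apply/not_notP.
    by rewrite lerDl sumr_ge0// => b _; rewrite indicE.
  lra.
apply: le_trans (ler_wsum_in volume_ge0 lower); rewrite -/K wsumZ.
rewrite ler_wpM2l ?sqr_ge0//.
have -> : wsum volume (layer r) (fun s => v s / 2 - 1 / 16 - hit s / 2) =
    2^-1 * wsum volume (layer r) v + (- (1 / 16)) * wsum volume (layer r) (fun=> 1)
    + (- 2^-1) * wsum volume (layer r) hit.
  rewrite -!wsumZ -!wsumD; apply: eq_bigr => s _; congr (_ * _); by field.
rewrite wsum_layer1 (wsum_layer_martingale r mv) rd.
have hitN : wsum volume (layer r) hit <= N%:R * 2^-1 ^+ n.
  rewrite /wsum /hit; under eq_bigr do rewrite mulr_sumr.
  rewrite exchange_big/= -rn mulr_natl /N.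
  have -> : (2^-1 ^+ sumn r : R) *+ #|` A| = \sum_(a <- enum_fset A) 2^-1 ^+ sumn r.
    by rewrite big_const_seq count_predT iter_addr_0.
  by apply: ler_sum => a _; exact: wsum_layer_point.
have : N%:R * 2^-1 ^+ n <= 1 / 2 :> R.
  rewrite exprVn ler_pdivrMr ?exprn_gt0// mulrAC ler_pdivlMr// mul1r.
  by rewrite -natrX -natrM ler_nat mulnC.
lra.
Qed.

End energy.

(** * The set where the maximal function is large *)

Section final_estimate.
Context {R : realType} (d : nat).
Implicit Types (s q : seq interval_code) (A : {fset d.-tuple R}).

Definition bad_set A (lam : R) : set (d.-tuple R) :=
  \bigcup_(s in [set s | cube_code d s /\ lam < `|tilde_average A s|]) rect s.

Lemma measurable_bad_set A lam : measurable (bad_set A lam).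
Proof.
rewrite /bad_set bigcup_mkcond; apply: countable_bigcupT_measurable => [|s].
  exact: countableP.
by case: ifP => _; [exact: measurable_rect|exact: measurable0].
Qed.

Lemma rect_cube s x : cube_code d s -> @rect R d s x -> @rect R d [::] x.
Proof.
move=> cs sx t; have := dint_cube (cs t) (sx t).
by rewrite nth_nil /in_dint /= in_itv/= mul0r /len expr0 mulr1.
Qed.

Lemma bad_set_cube A lam : bad_set A lam `<=` @rect R d [::].
Proof. by move=> x [s [cs _]]; exact: rect_cube. Qed.

Lemma bad_set_maximal A lam x : [set` A] `<=` @unit_cube R d ->
  bad_set A lam x -> (lam%:E <= dyadic_maximal (tilde_discrepancy A) x)%E.
Proof.
move=> A01 [s [cs lams] sx]; apply: ereal_sup_ge.
exists (`|average (rect s) (tilde_discrepancy A)|%:E).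
  by exists (rect s) => //; split=> //; exact: dyadic_rect.
by rewrite lee_fin average_tilde// ltW.
Qed.

(** If the bad set had measure less than 1/4, its complement in the cube could play
    the role of the good set, and the lower bounds of [layer_energy] over the level
    vectors with sum n would contradict [square_function_bound].  The constant
    256^(d+1) is the product of 16^d from the latter and 16^d 256 from the former. *)
Lemma large_bad_set A (lam : R) k n : d = k.+1 ->
  (2 * #|` A| <= 2 ^ n <= 4 * #|` A|)%N -> 0 <= lam ->
  (k`! * 256 ^ k.+2)%:R * lam ^+ 2 < n%:R ^+ k ->
  ((1 / 4)%:E <= lebesgueRn d (bad_set A lam))%E.
Proof.
move=> dk An lam0; apply: contraPP => /negP; rewrite -ltNge => badlt.
apply/negP; rewrite -leNgt.
set E := bad_set A lam in badlt.
have mE : measurable E by exact: measurable_bad_set.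
pose F := @rect R d [::] `\` E.
have mF : measurable F by apply: measurableD => //; exact: measurable_rect.
have cube1 : lebesgueRn d (@rect R d [::]) = 1%E.
  by rewrite lebesgue_rect (rect_volume_nseq0 d 0).
pose nu : {measure set (d.-tuple R) -> \bar R} := mrestr (lebesgueRn d) mF.
have nule s : (nu (rect s) <= (rect_volume d s)%:E)%E.
  rewrite -lebesgue_rect; apply: le_measure; rewrite ?inE//.
  - by apply: measurableI => //; exact: measurable_rect.
  - exact: measurable_rect.
have fin_nu : (nu setT < +oo)%E.
  rewrite /nu /= /mrestr setTI; apply: (@le_lt_trans _ _ 1%E); last exact: ltry.
  by rewrite -cube1; apply: le_measure; rewrite ?inE//; [exact: measurable_rect|exact: subDsetl].
pose v s := fine (nu (rect s)) / rect_volume d s.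
have mv : martingale v by exact: martingale_measure.
have v01 s : 0 <= v s <= 1.
  have rv0 := @rect_volume_gt0 R d s.
  apply/andP; split; first by apply: divr_ge0; [exact/fine_ge0/measure_ge0|exact: ltW].
  rewrite /v ler_pdivrMr// mul1r.
  by rewrite -[leRHS]/(fine (rect_volume d s)%:E) fine_le// ge0_fin_numE// (le_lt_trans (nule s))// ltry.
have v0 : 3 / 4 <= v (nseq d (0, 0)%N).
  rewrite /v rect_volume_nseq0 divr1 rect_nseq0.
  have -> : nu (@rect R d [::]) = (lebesgueRn d (@rect R d [::]) - lebesgueRn d E)%E.
    rewrite /nu /= /mrestr setIDA setIid measureD//; [|exact: measurable_rect|by rewrite [ltLHS]cube1 ltry].
    by congr (_ - lebesgueRn d _)%E; apply: setIidr; exact: bad_set_cube.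
  have Efin : lebesgueRn d E \is a fin_num.
    by rewrite ge0_fin_numE// (lt_trans badlt)// ltry.
  rewrite [lebesgueRn d (rect [::])]cube1; move: badlt; rewrite -(fineK Efin) lte_fin -EFinB/=.
  lra.
have vanish s q : refines q s -> (rect s `&` F = set0) -> v q = 0.
  move=> qs sF; rewrite /v /nu /= /mrestr (_ : rect q `&` F = set0) ?measure0 ?mul0r//.
  by apply/seteqP; split=> // x [qx Fx]; rewrite -sF; split=> //; exact: refines_rect qx.
have dominated s : `|tilde_average A s| <= lam \/ forall q, refines q s -> v q = 0.
  have [ule|ugt] := leP `|tilde_average A s| lam; [by left|right => q qs].
  apply: (vanish s) => //; apply/seteqP; split=> // x [sx [x01 nEx]].
  by apply: nEx; exists s => //; split=> //; exact: rect_outside x01.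
(* The levels 0, ..., n suffice, since the levels considered below have sum n. *)
have := square_function_bound n.+1 d lam0 (martingale_tilde A) mv dominated.
set W := wsum _ _ _ => Wle.
have cells1 : wsum volume (words (level n.+1) d) (fun s => v s ^+ 2) <= 1.
  apply: (@le_trans _ _ (wsum volume (words (level n.+1) d) v)).
    apply: ler_wsum => s; first exact: volume_ge0.
    by have /andP[vs0 vs1] := v01 s; rewrite expr2 ler_piMl.
  by rewrite words_level wsum_layer_martingale//; case/andP: (v01 (nseq (size (nseq d n.+1)) (0, 0)%N)).
have {Wle} Wle : W <= 16 ^+ d * lam ^+ 2.
  apply: le_trans Wle _; rewrite -[leRHS]mulr1; apply: ler_wpM2l => //.
  by apply: mulr_ge0; [exact: exprn_ge0|exact: sqr_ge0].
set count_n := count (fun r => sumn r == n) (words (iota 0 n.+1) d).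
have Wge : count_n%:R * ((4 ^+ d * 4)^-1 ^+ 2 / 16) <= W.
  rewrite /W /wsum big_words_tree /count_n -sum1_count natr_sum mulr_suml big_mkcond/=.
  rewrite big_seq [leRHS]big_seq; apply: ler_sum => r rw.
  case: eqP => [rn|_].
    rewrite mul1r; apply: (@layer_energy R d A v r n) => //.
    exact: size_words rw.
  apply: sumr_ge0 => s _; rewrite mulr_ge0 ?volume_ge0//.
  by rewrite mulr_ge0 ?sqr_ge0.
have := count_words_sum n k; rewrite -dk -/count_n => nk.
have {nk} : n%:R ^+ k <= k`!%:R * count_n%:R :> R by rewrite -natrX -natrM ler_nat.
move=> /le_trans; apply; rewrite natrM -mulrA ler_wpM2l//.
apply: le_trans (_ : (256 * 16 ^+ d) * W <= _).
  rewrite -ler_pdivrMl ?mulr_gt0 ?exprn_gt0// mulrC; apply: le_trans Wge.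
  rewrite ler_wpM2l// [leRHS](_ : _ = (256 * 16 ^+ d)^-1)//.
  have -> : 16 = 4 ^+ 2 :> R by ring.
  rewrite exprAC; have : 4 ^+ d != 0 :> R by rewrite expf_neq0.
  by move: (4 ^+ d) => z z0; field.
rewrite natrX exprS -mulrA -mulrA ler_wpM2l//.
have -> : 256 ^+ d = 16 ^+ d * 16 ^+ d :> R.
  by rewrite -exprMn; congr (_ ^+ _); ring.
by rewrite -mulrA ler_wpM2l// exprn_ge0.
Qed.

End final_estimate.

Theorem theorem5p3 (R : realType) (d : nat) (p : R) :
  (2 <= d)%N -> 0 < p <= 1 ->
  exists c : R, 0 < c /\
    forall (N : nat) (A : {fset d.-tuple R}),
      (1 <= N)%N -> [set` A] `<=` @unit_cube R d -> #|` A|%fset = N ->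
      ((c * ln N%:R `^ (d.-1%:R / 2))%:E <=
       hardy_norm p (tilde_discrepancy A))%E.
Proof.
move=> d2 /andP[p0 _].
case: d d2 => [//|k] _; rewrite [k.+1.-1]/=.
pose K : R := (k`! * 256 ^ k.+2)%:R.
have K1 : 1 <= K by rewrite ler1n muln_gt0 fact_gt0 expn_gt0.
have K0 : 0 < K by exact: lt_le_trans K1.
exists ((2 * K)^-1 * (1 / 4) `^ p^-1); split.
  by rewrite mulr_gt0 ?powR_gt0 ?invr_gt0 ?mulr_gt0// divr_gt0.
move=> N A N1 A01 AN.
have lnN0 : 0 <= ln N%:R :> R by rewrite ln_ge0// ler1n.
set L := ln N%:R `^ (k%:R / 2).
have L0 : 0 <= L by exact: powR_ge0.
have L2 : L ^+ 2 = ln N%:R ^+ k.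
  by rewrite -powR_mulrn// /L -powRrM -mulrA mulVf// mulr1 powR_mulrn.
(* 2^m <= N < 2^(m+1) for m = trunc_log 2 N, hence 2N < 2^n <= 4N. *)
pose n := (trunc_log 2 N).+2.
have /andP[nN Nn] := trunc_log_bounds (isT : 1 < 2)%N N1.
have An : (2 * #|` A| <= 2 ^ n <= 4 * #|` A|)%N.
  rewrite AN /n; move: nN Nn; rewrite !expnS; lia.
have lnn : ln N%:R <= n%:R :> R.
  have N0 : 0 < N%:R :> R by rewrite ltr0n.
  apply: (@le_trans _ _ (ln ((2 : R) ^+ n))).
    rewrite ler_ln ?posrE ?exprn_gt0// -natrX ler_nat.
    by move: An; rewrite AN => /andP[+ _]; lia.
  rewrite lnXn// -[leRHS]mulr1 mulr_natl ler_wMn2r//.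
  by have := @le_ln1Dx R 1; rewrite -[1 + 1]/(2 : R); apply; lra.
rewrite mulrAC; apply: (@hardy_norm_ge R k.+1 _ p _ _ (bad_set A ((2 * K)^-1 * L))) => //.
- by rewrite mulr_ge0// invr_ge0 mulr_ge0// ltW.
- exact: measurable_bad_set.
- apply: (@large_bad_set R k.+1 A _ k n) => //.
    by rewrite mulr_ge0// invr_ge0 mulr_ge0// ltW.
  rewrite -/K exprMn L2.
  have cancel (a b : R) : 0 < a -> a * ((2 * a)^-1 ^+ 2 * b) = (4 * a)^-1 * b.
    by move=> a0; field; rewrite gt_eqF.
  rewrite cancel//.
  apply: (@le_lt_trans _ _ ((4 * K)^-1 * n%:R ^+ k)).
    rewrite ler_wpM2l ?invr_ge0 ?mulr_ge0 ?(ltW K0)//.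
    by rewrite lerXn2r ?nnegrE// (le_trans lnN0).
  rewrite gtr_pMl ?exprn_gt0 ?ltr0n// invf_lt1; lra.
- by move=> x; exact: bad_set_maximal.
Qed.
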